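(* Let $(\overline{M},\varphi,\xi,\eta,\overline{g})$ be a Lorentzian para-Sasakian manifold and let $i:M\to\overline{M}$ be an invariant hypersurface with $\xi$ everywhere tangent to $M$. Then $M$ is also a Lorentzian para-Sasakian manifold, with the induced structure $(\psi,\xi^*,\eta^*,g^* )$.
   Context: A $(1,1,1)$ ac structure on an $n$-dimensional differentiable manifold $\overline{M}$ is a triple $(\varphi,\xi,\eta)$ of a $(1,1)$-tensor field, a nowhere vanishing vector field and a $1$-form with $\varphi\xi=0$ and $\varphi^2=I+\eta\otimes\xi$ (hence $\eta\circ\varphi=0$, $\eta(\xi)=-1$). A Lorentzian almost paracontact manifold is a $(1,1,1)$ ac manifold with a Lorentzian metric $\overline{g}$ satisfying $\overline{g}(\overline{X},\xi)=\eta(\overline{X})$ and $\overline{g}(\varphi\overline{X},\varphi\overline{Y})=\overline{g}(\overline{X},\overline{Y})+\eta(\overline{X})\eta(\overline{Y})$. It is Lorentzian para-Sasakian if, with $\overline{\nabla}$ the Levi-Civita connection of $\overline{g}$, $$(\overline{\nabla}_{\overline X}\varphi)\overline Y=\eta(\overline Y)\overline X+\overline g(\overline X,\overline Y)\xi+2\eta(\overline X)\eta(\overline Y)\xi.$$ Let $M$ be an $(n-1)$-dimensional manifold imbedded in $\overline{M}$ by $i$, with $\xi_{i(p)}\in i_*(T_pM)$ for each $p\in M$. The hypersurface is invariant if $\varphi$ maps tangent vectors of $M$ to tangent vectors, i.e. $\varphi i_*X=i_*\psi X$ for a $(1,1)$-tensor field $\psi$ on $M$. The induced objects on $M$ are defined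 by $\varphi i_*X=i_*\psi X$, $i_*\xi^*=\xi$, $\eta^*(X)=\eta(i_*X)$ and $g^*(X,Y)=\overline g(i_*X,i_*Y)$. *)

(* Defs.v *)
From HB Require Import structures.
From mathcomp Require Import all_boot all_order all_algebra.
From mathcomp Require Import all_classical all_reals all_analysis.

Set Implicit Arguments.
Unset Strict Implicit.
Unset Printing Implicit Defensive.

Import Order.TTheory GRing.Theory Num.Theory.
Import numFieldNormedType.Exports.

Local Open Scope classical_set_scope.
Local Open Scope ring_scope.

(* C^k maps on an open subset U of a finite-dimensional space: a map is
   C^(k+1) when it is differentiable on U and all its directional derivatives
   are C^k on U. *)
Fixpoint Ck (R : realType) (V W : normedModType R) (k : nat) (U : set V)
    (f : V -> W) : Prop :=
  match k with
  | 0%N => forall x, U x -> {for x, continuous f}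
  | k'.+1 => (forall x, U x -> differentiable f x) /\
             (forall v : V, Ck k' U (fun x => 'D_v f x))
  end.

Definition Csmooth (R : realType) (V W : normedModType R) (U : set V)
    (f : V -> W) : Prop := forall k, Ck k U f.

(* A chart: coord is a homeomorphism from the open set dom onto an open subset
   of R^n, with inverse param. Values of coord outside dom, and of param
   outside the image of dom, are irrelevant. *)
Record chart (R : realType) (n : nat) (T : topologicalType) := Chart {
  dom : set T;
  coord : T -> 'rV[R]_n;
  param : 'rV[R]_n -> T;
  dom_open : open dom;
  codom_open : open (coord @` dom);
  coordK : forall p, dom p -> param (coord p) = p;
  coord_cts : forall p, dom p -> {for p, continuous coord};
  param_cts : forall x, (coord @` dom) x -> {for x, continuous param} }.

Record manifold (R : realType) (n : nat) := Manifold {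
  carrier :> topologicalType;
  carrier_hausdorff : hausdorff_space carrier;
  carrier_second_countable : @second_countable carrier;
  atlas : set (chart R n carrier);
  atlas_compat : forall c d, atlas c -> atlas d ->
    Csmooth (coord c @` (dom c `&` dom d)) (coord d \o param c);
  chart_at : carrier -> chart R n carrier;
  chart_at_atlas : forall p, atlas (chart_at p);
  chart_at_dom : forall p, dom (chart_at p) p }.

(* The tangent space T_pM is represented by 'rV[R]_n: a tangent vector at p is
   given by its components in the selected chart [chart_at M p]. Since the
   selected chart varies arbitrarily with p, smoothness of fields is always
   expressed after passing to the components in a fixed chart. *)

Section Fields.
Variables (R : realType) (n : nat) (M : manifold R n).
Implicit Types (p : M) (c : chart R n M).

Definition vfield := M -> 'rV[R]_n.
Definition oneform := M -> 'rV[R]_n -> R.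
Definition tensor11 := M -> 'rV[R]_n -> 'rV[R]_n.
Definition tensor02 := M -> 'rV[R]_n -> 'rV[R]_n -> R.

(* the components in the chart c of the tangent vector v at p *)
Definition to_chart c p (v : 'rV[R]_n) : 'rV[R]_n :=
  'd (coord c \o param (chart_at p)) (coord (chart_at p) p) v.

(* the tangent vector at p whose components in the chart c are u *)
Definition of_chart c p (u : 'rV[R]_n) : 'rV[R]_n :=
  'd (coord (chart_at p) \o param c) (coord c p) u.

(* A map s defined on M is read in the chart c as s \o param c; the following
   says that it is smooth on the open set U in each chart, for a family of
   maps s which may depend on the chart. *)
Definition smooth_in_charts (W : normedModType R) (U : set M)
    (s : chart R n M -> M -> W) : Prop :=
  forall c, atlas c -> Csmooth (coord c @` (dom c `&` U)) (s c \o param c).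

Definition smooth_fun (U : set M) (f : M -> R) : Prop :=
  smooth_in_charts U (fun _ => f).

Definition smooth_vfield (U : set M) (X : vfield) : Prop :=
  smooth_in_charts U (fun c p => to_chart c p (X p)).

Definition smooth_oneform (eta : oneform) : Prop :=
  (forall p, scalar (eta p)) /\
  (forall u, smooth_in_charts setT (fun c p => eta p (of_chart c p u))).

Definition smooth_tensor11 (phi : tensor11) : Prop :=
  (forall p, linear (phi p)) /\
  (forall u, smooth_in_charts setT
     (fun c p => to_chart c p (phi p (of_chart c p u)))).

Definition smooth_tensor02 (g : tensor02) : Prop :=
  (forall p v, scalar (g p v) /\ scalar (fun w => g p w v)) /\
  (forall u w, smooth_in_charts setT
     (fun c p => g p (of_chart c p u) (of_chart c p w))).

(* v f, for a tangent vector v at p *)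
Definition dderiv p (v : 'rV[R]_n) (f : M -> R) : R :=
  'd (f \o param (chart_at p)) (coord (chart_at p) p) v.

Definition fun_near p (f : M -> R) : Prop :=
  exists2 U, open_nbhs p U & smooth_fun U f.

Definition vfield_near p (X : vfield) : Prop :=
  exists2 U, open_nbhs p U & smooth_vfield U X.

(* Affine connections act on locally defined smooth vector fields, i.e. on
   vector fields which are smooth near the point under consideration. *)
Record affine_connection (nabla : vfield -> vfield -> vfield) : Prop := {
  nabla_smooth : forall p X Y, vfield_near p X -> vfield_near p Y ->
    vfield_near p (nabla X Y);
  nabla_linl : forall p f X X' Y, fun_near p f -> vfield_near p X ->
    vfield_near p X' -> vfield_near p Y ->
    nabla (fun q => f q *: X q + X' q) Y p = f p *: nabla X Y p + nabla X' Y p;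
  nabla_addr : forall p X Y Y', vfield_near p X -> vfield_near p Y ->
    vfield_near p Y' ->
    nabla X (fun q => Y q + Y' q) p = nabla X Y p + nabla X Y' p;
  nabla_leibniz : forall p f X Y, fun_near p f -> vfield_near p X ->
    vfield_near p Y ->
    nabla X (fun q => f q *: Y q) p = dderiv p (X p) f *: Y p + f p *: nabla X Y p
  }.

(* nabla_X Y - nabla_Y X = [X, Y], where [X, Y] f = X (Y f) - Y (X f) *)
Definition torsion_free (nabla : vfield -> vfield -> vfield) : Prop :=
  forall p X Y f, vfield_near p X -> vfield_near p Y -> fun_near p f ->
    dderiv p (nabla X Y p - nabla Y X p) f =
    dderiv p (X p) (fun q => dderiv q (Y q) f)
    - dderiv p (Y p) (fun q => dderiv q (X q) f).

Definition metric_compatible (g : tensor02)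
    (nabla : vfield -> vfield -> vfield) : Prop :=
  forall p X Y Z, vfield_near p X -> vfield_near p Y -> vfield_near p Z ->
    dderiv p (X p) (fun q => g q (Y q) (Z q)) =
    g p (nabla X Y p) (Z p) + g p (Y p) (nabla X Z p).

Definition levi_civita (g : tensor02) (nabla : vfield -> vfield -> vfield) :
    Prop :=
  [/\ affine_connection nabla, torsion_free nabla & metric_compatible g nabla].

(* signature (-,+,...,+): the rows of P are a pseudo-orthonormal basis with
   exactly one timelike vector, of index i0 *)
Definition lorentzian_form (b : 'rV[R]_n -> 'rV[R]_n -> R) : Prop :=
  exists (i0 : 'I_n) (P : 'M[R]_n), P \in unitmx /\
    forall i j, b (row i P) (row j P) =
      if i == j then (if i == i0 then -1 else 1) else 0.

Definition lorentzian_metric (g : tensor02) : Prop :=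
  [/\ smooth_tensor02 g, (forall p v w, g p v w = g p w v)
    & forall p, lorentzian_form (g p)].

Record ac111_structure (phi : tensor11) (xi : vfield) (eta : oneform) :
    Prop := {
  ac_phi : smooth_tensor11 phi;
  ac_xi : smooth_vfield setT xi;
  ac_eta : smooth_oneform eta;
  ac_xi_neq0 : forall p, xi p != 0;
  ac_phi_xi : forall p, phi p (xi p) = 0;
  ac_phi2 : forall p v, phi p (phi p v) = v + eta p v *: xi p }.

Record lorentzian_almost_paracontact (phi : tensor11) (xi : vfield)
    (eta : oneform) (g : tensor02) : Prop := {
  lap_ac : ac111_structure phi xi eta;
  lap_metric : lorentzian_metric g;
  lap_xi : forall p v, g p v (xi p) = eta p v;
  lap_phi : forall p v w,
    g p (phi p v) (phi p w) = g p v w + eta p v * eta p w }.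

Definition nabla_tensor11 (nabla : vfield -> vfield -> vfield)
    (phi : tensor11) (X Y : vfield) : vfield :=
  fun p => nabla X (fun q => phi q (Y q)) p - phi p (nabla X Y p).

(* On smooth vector fields, nabla is determined by levi_civita g nabla. *)
Definition lorentzian_para_sasakian (phi : tensor11) (xi : vfield)
    (eta : oneform) (g : tensor02) : Prop :=
  lorentzian_almost_paracontact phi xi eta g /\
  exists nabla, levi_civita g nabla /\
    forall p X Y, vfield_near p X -> vfield_near p Y ->
      nabla_tensor11 nabla phi X Y p =
      eta p (Y p) *: X p + g p (X p) (Y p) *: xi p
      + (2 * eta p (X p) * eta p (Y p)) *: xi p.

End Fields.

Section Maps.
Variables (R : realType) (m n : nat) (M : manifold R m) (N : manifold R n).
Implicit Type i : M -> N.

Definition smooth_map i : Prop :=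
  continuous i /\
  forall c d, atlas c -> atlas d ->
    Csmooth (coord c @` (dom c `&` i @^-1` dom d)) (coord d \o i \o param c).

(* i_* at p *)
Definition push i (p : M) (v : 'rV[R]_m) : 'rV[R]_n :=
  'd (coord (chart_at (i p)) \o i \o param (chart_at p))
     (coord (chart_at p) p) v.

Record imbedding i : Prop := {
  imb_smooth : smooth_map i;
  imb_immersion : forall p, injective (push i p);
  imb_inj : injective i;
  imb_homeo : forall U : set M, open U ->
    exists2 V : set N, open V & U = i @^-1` V }.

Definition invariant_under i (phi : tensor11 N) : Prop :=
  forall p v, exists w, phi (i p) (push i p v) = push i p w.

Definition tangent_along i (xi : vfield N) : Prop :=
  forall p, exists w, push i p w = xi (i p).

Definition pullback1 i (eta : oneform N) : oneform M :=
  fun p v => eta (i p) (push i p v).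

Definition pullback2 i (g : tensor02 N) : tensor02 M :=
  fun p v w => g (i p) (push i p v) (push i p w).

End Maps.

(* Main.v *)
From HB Require Import structures.
From mathcomp Require Import all_boot all_order all_algebra.
From mathcomp Require Import all_classical all_reals all_analysis.
From mathcomp Require Import perm ring lra.
Require Import Defs.

Set Implicit Arguments.
Unset Strict Implicit.
Unset Printing Implicit Defensive.

Import Order.TTheory GRing.Theory Num.Theory.
Import numFieldNormedType.Exports.

Local Open Scope classical_set_scope.
Local Open Scope ring_scope.

(** The induced structure is the restriction of the ambient one to the tangent
    spaces of M, and its Levi-Civita connection is obtained from the ambient one
    by the Gauss formula: differentiate the field i_* Y along X with the ambient
    connection, then project on T_p M orthogonally for the ambient metric.

    The metric part is linear algebra. In a Lorentzian space with
    g(xi, xi) = -1, the form g + 2 eta (x) eta is positive definite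
    ([lorentzian_posdef]); this property passes to subspaces that contain xi and
    forces the signature (-,+,...,+) on them ([posdef_lorentzian]). In
    particular the induced metric is nondegenerate, so that the orthogonal
    projection exists, and a field on M is smooth as soon as its products with
    coordinate fields are ([smooth_dual]). This gives the smoothness of psi, of
    xi* and of the connection.

    The Gauss connection is computed in one chart c of M and one chart d of the
    ambient manifold, where the derivative of i_* Y is D(di Y)(X) plus the
    ambient Christoffel term. Working with fields along i
    avoids extending vector fields off M: the ambient axioms are used on
    coordinate fields, and the chain rule does the rest. The second derivative of i enters symmetrically (theorem of
    Schwarz, [schwarz_real]), which gives vanishing torsion
    ([chart_gauss_torsion]); metric compatibility is the product rule
    ([chart_gauss_metric]). Since these two properties determine the connection
    at each point ([levi_civita_unique]), the construction does not depend on
    c and d ([chart_gauss_indep]); hence the pointwise definition with the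
    selected charts is smooth ([gauss_levi_civita]).

    For the structure equation, the same chain rule gives
    D_X(phi i_* Y) - phi D_X(i_* Y) = (nabla_X phi) i_* Y along M
    ([ambient_cov_psi]). The right-hand side is tangent to M by the ambient
    equation, and phi, being self-adjoint and preserving the tangent spaces,
    commutes with the projection ([tanproj_phi]). Projecting therefore gives
    the equation for psi. *)

(** * Differentials of functions that agree near a point *)

Section NearDiff.
Variables (R : realType) (V W : normedModType R).
Implicit Types (f g : V -> W) (x : V).

Lemma near0_is_diff f x : (\forall y \near x, f y = 0) -> is_diff x f 0.
Proof.
move=> f0; have fx : f x = 0 by exact: nbhs_singleton f0.
have E : f \o shift x = cst (f x) + (\0 : {linear V -> W}) +o_ 0 id.
  apply/eqaddoP => _ /posnumP[e]; near=> h.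
  rewrite /= !fctE fx /= addr0 subr0.
  rewrite (_ : f (h + x) = 0) ?normr0 ?mulr_ge0//.
  near: h; move: f0; rewrite (near_shift 0)/=.
  by apply: filterS => y; rewrite /= subr0.
have c0 : continuous (\0 : {linear V -> W}) by exact: cst_continuous.
have D : 'd f x = (\0 : {linear V -> W}) :> (V -> W) by exact: diff_unique.
by apply: DiffDef; [apply/diff_locallyP; rewrite D|rewrite D].
Unshelve. all: by end_near. Qed.

(** The difference of the two functions vanishes near x, hence has differential 0. *)
Lemma near_eq_is_diff f g (df : V -> W) x :
  (\forall y \near x, f y = g y) -> is_diff x f df -> is_diff x g df.
Proof.
move=> fg dfx; have h0 : is_diff x (g - f) 0.
  by apply: near0_is_diff; apply: filterS fg => y fgy; rewrite !fctE fgy subrr.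
have := is_diffD dfx h0.
by rewrite addr0 addrC subrK.
Qed.

Lemma near_eq_differentiable f g x :
  (\forall y \near x, f y = g y) -> differentiable f x -> differentiable g x.
Proof.
move=> fg df; have dfx : is_diff x f ('d f x) by exact: DiffDef.
by have [] := near_eq_is_diff fg dfx.
Qed.

Lemma near_eq_diff f g x :
  (\forall y \near x, f y = g y) -> differentiable f x ->
  'd f x = 'd g x :> (V -> W).
Proof.
move=> fg df; have dfx : is_diff x f ('d f x) by exact: DiffDef.
by have [_ ->] := near_eq_is_diff fg dfx.
Qed.

Lemma near_eq_diff_val f g x v :
  (\forall y \near x, f y = g y) -> differentiable f x -> 'd g x v = 'd f x v.
Proof. by move=> fg df; rewrite (near_eq_diff fg df). Qed.

End NearDiff.

(** * The product rule for scalar multiplication *)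

Section ScaleDiff.
Variables (R : realType) (V W : normedModType R).

Lemma scale_is_bilinear :
  bilinear_for
    (GRing.Scale.Law.clone _ _ *:%R _) (GRing.Scale.Law.clone _ _ *:%R _)
    (@GRing.scale R W).
Proof.
split=> [u'|u] a x y /=.
- by rewrite scalerDl scalerA.
- by rewrite scalerDr !scalerA mulrC.
Qed.
HB.instance Definition _ := bilinear_isBilinear.Build R R W W _ _
  (@GRing.scale R W) scale_is_bilinear.

Lemma is_diff_scale (a : V -> R) (u : V -> W) (da : V -> R) (du : V -> W) x :
  is_diff x a da -> is_diff x u du ->
  is_diff x (fun y => a y *: u y) (fun h => a x *: du h + da h *: u x).
Proof.
move=> dax dux.
have cs : continuous (fun p : R * W => p.1 *: p.2).
  move=> p; exact: scale_continuous.
have S : is_diff (a x, u x) (fun p : R * W => p.1 *: p.2)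
    (fun q => a x *: q.2 + q.1 *: u x).
  apply: DiffDef; first by apply: (@differentiable_bilin _ _ _ _ (@GRing.scale R W)).
  by rewrite (@diff_bilin _ _ _ _ (@GRing.scale R W)).
have P := is_diff_pair dax dux.
exact: (@is_diff_comp _ _ _ _ (fun y => (a y, u y)) _ _ _ x P S).
Qed.

End ScaleDiff.

(** * Calculus of maps of class C^k on an open set *)

Lemma open_near (T : topologicalType) (U : set T) x :
  open U -> U x -> \forall y \near x, U y.
Proof. by move=> oU Ux; exact: open_nbhs_nbhs. Qed.

Section CkTheory.
Variables (R : realType) (V W : normedModType R).
Implicit Types (U : set V) (f g : V -> W).

(** All conditions in the definition of C^k are pointwise. *)
Lemma Ck_glue k U f :
  (forall x, U x -> exists2 U', U' x & Ck k U' f) -> Ck k U f.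
Proof.
elim: k f => [|k IH] f H /=; first by move=> x /H[U' U'x]; apply.
split=> [x /H[U' U'x [+ _]]|v]; first by apply.
by apply: IH => x /H[U' U'x [_ /(_ v) Df]]; exists U'.
Qed.

Lemma Ck_sub k U U' f : U `<=` U' -> Ck k U' f -> Ck k U f.
Proof. by move=> UU' H; apply: Ck_glue => x /UU' U'x; exists U'. Qed.

Lemma CkW k U f : Ck k.+1 U f -> Ck k U f.
Proof.
elim: k f => [|k IH] f [df Df].
  by move=> x Ux; exact/differentiable_continuous/df.
by split=> [|v]; [exact: df|exact: IH _ (Df v)].
Qed.

Lemma Ck_eq k U f g : open U -> (forall x, U x -> f x = g x) ->
  Ck k U f -> Ck k U g.
Proof.
move=> oU; elim: k f g => [|k IH] f g fg.
  move=> cf x Ux; have := cf _ Ux; rewrite /prop_for /continuous_at (fg _ Ux) => c.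
  apply: cvg_trans c; apply: near_eq_cvg.
  by apply: filterS (open_near oU Ux) => y /fg ->.
move=> [df Df]; split=> [x Ux|v].
  by apply: near_eq_differentiable (df _ Ux); apply: filterS (open_near oU Ux).
apply: IH (Df v) => x Ux; apply: near_eq_derive.
by apply: filterS (open_near oU Ux).
Qed.

Lemma Ck_cst k U (a : W) : Ck k U (fun _ : V => a).
Proof.
elim: k a => [|k IH] a; first by move=> x _; exact: cst_continuous.
split=> [x _|v]; first exact: differentiable_cst.
have -> : (fun x : V => 'D_v (fun _ : V => a) x) = fun=> 0 by apply/funext => x; exact: derive_cst.
exact: IH.
Qed.

Lemma CkD k U f g : open U -> Ck k U f -> Ck k U g ->
  Ck k U (fun x => f x + g x).
Proof.
move=> oU; elim: k f g => [|k IH] f g.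
  by move=> cf cg x Ux; apply: continuousD; [exact: cf|exact: cg].
move=> [df Df] [dg Dg]; split=> [x Ux|v].
  by apply: differentiableD; [exact: df|exact: dg].
apply: Ck_eq (IH _ _ (Df v) (Dg v)) => // x Ux.
have dfx : derivable f x v by exact/diff_derivable/df.
have dgx : derivable g x v by exact/diff_derivable/dg.
exact/esym/(deriveD dfx dgx).
Qed.

Lemma Ck_sum k U (I : Type) (r : seq I) (P : pred I) (f : I -> V -> W) :
  open U -> (forall i, P i -> Ck k U (f i)) ->
  Ck k U (fun x => \sum_(i <- r | P i) f i x).
Proof.
move=> oU Hf; elim: r => [|i r IH].
  by apply: Ck_eq (Ck_cst k U 0) => // x _; rewrite big_nil.
have [Pi|Pi] := boolP (P i); last first.
  by apply: Ck_eq IH => // x _; rewrite big_cons (negbTE Pi).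
by apply: Ck_eq (CkD oU (Hf i Pi) IH) => // x _; rewrite big_cons Pi.
Qed.

End CkTheory.

Section CkScale.
Variables (R : realType) (V W : normedModType R).
Implicit Types (U : set V) (f : V -> W).

Lemma deriv_scale (a : V -> R) f x v : differentiable a x ->
  differentiable f x ->
  'D_v (fun y => a y *: f y) x = a x *: 'D_v f x + 'D_v a x *: f x.
Proof.
move=> da df; have da' : is_diff x a ('d a x) by exact: DiffDef.
have df' : is_diff x f ('d f x) by exact: DiffDef.
have [D E] := is_diff_scale da' df'.
by rewrite [LHS]deriveE// E !deriveE.
Qed.

Lemma CkZ k U (a : V -> R) f : open U -> Ck k U a -> Ck k U f ->
  Ck k U (fun x => a x *: f x).
Proof.
move=> oU; elim: k a f => [|k IH] a f.
  by move=> ca cf x Ux; apply: continuousZ; [exact: ca|exact: cf].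
move=> Da Df; have Da0 := CkW Da; have Df0 := CkW Df.
case: Da Df => [da Da] [df Df]; split=> [x Ux|v].
  have da' : is_diff x a ('d a x) by apply: DiffDef => //; exact: da.
  have df' : is_diff x f ('d f x) by apply: DiffDef => //; exact: df.
  by have [] := is_diff_scale da' df'.
have := CkD oU (IH _ _ Da0 (Df v)) (IH _ _ (Da v) Df0).
by apply: Ck_eq => // x Ux; rewrite deriv_scale//; [exact: da|exact: df].
Qed.

End CkScale.

Section CkScalar.
Variables (R : realType) (V : normedModType R).
Implicit Types (U : set V) (f g : V -> R).

Lemma CkM k U f g : open U -> Ck k U f -> Ck k U g ->
  Ck k U (fun x => f x * g x).
Proof. exact: CkZ. Qed.

(** By induction on k, from (1 / f)' = - (1 / f)^2 f'. *)
Lemma CkV k U f : open U -> (forall x, U x -> f x != 0) -> Ck k U f ->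
  Ck k U (fun x => (f x)^-1).
Proof.
move=> oU f0; elim: k f f0 => [|k IH] f f0.
  by move=> cf x Ux; apply: continuousV; [exact: f0|exact: cf].
move=> Df; have Dv := IH _ f0 (CkW Df); case: Df => df Df.
split=> [x Ux|v]; first by apply: differentiableV; [exact: df|exact: f0].
have := CkM oU (CkM oU (Ck_cst k U (-1 : R)) (CkM oU Dv Dv)) (Df v).
apply: Ck_eq => // x Ux; rewrite [RHS]deriveV; [|exact: f0|exact/diff_derivable/df].
by rewrite mulN1r -expr2 -exprVn.
Qed.

End CkScalar.

Section CkRow.
Variables (R : realType) (V : normedModType R).
Implicit Types (U : set V).

Lemma row_sum_coord m (u : 'rV[R]_m) : u = \sum_j u 0 j *: 'e_j.
Proof. by rewrite [LHS]row_sum_delta. Qed.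

Lemma deriv_coord m n (f : V -> 'M[R]_(m, n)) x v i j : differentiable f x ->
  'D_v (fun y => f y i j) x = ('D_v f x) i j.
Proof. by move=> df; rewrite derive_mx ?mxE//; exact: diff_derivable. Qed.

Lemma Ck_coord k U m n (f : V -> 'M[R]_(m, n)) i j : open U -> Ck k U f ->
  Ck k U (fun x => f x i j).
Proof.
move=> oU; elim: k f => [|k IH] f.
  move=> cf x Ux; apply: (@continuous_comp _ _ _ f (fun M => M i j)).
    exact: cf.
  exact: coord_continuous.
move=> [df Df]; split=> [x Ux|v].
  apply: (@differentiable_comp _ _ _ _ f (fun M => M i j)); first exact: df.
  exact: differentiable_coord.
by apply: Ck_eq (IH _ (Df v)) => // x Ux; rewrite deriv_coord//; exact: df.
Qed.

Lemma linear_rowE m (W : lmodType R) (f : 'rV[R]_m -> W) (u : 'rV[R]_m) :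
  linear f -> f u = \sum_j u 0 j *: f 'e_j.
Proof.
move=> lf; pose fl := GRing.isLinear.Build _ _ _ _ _ lf.
pose F : {linear _ -> _} := HB.pack f fl.
have -> : f = F by [].
by rewrite [in LHS](row_sum_coord u) linear_sum; apply: eq_bigr => j _; rewrite linearZ.
Qed.

(** By induction on k: the derivative of f o g in the direction v is the sum of
    the products (D_v g)_j (D_j f) o g, to which the induction hypothesis and the
    product rule apply. *)
Lemma Ck_comp k U m (U' : set 'rV[R]_m) (W : normedModType R)
    (g : V -> 'rV[R]_m) (f : 'rV[R]_m -> W) : open U -> open U' -> (forall x, U x -> U' (g x)) ->
  Ck k U g -> Ck k U' f -> Ck k U (fun x => f (g x)).
Proof.
move=> oU oU' gU; elim: k W f => [|k IH] W f.
  by move=> cg cf x Ux; apply: (@continuous_comp _ _ _ g f);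
    [exact: cg|exact/cf/gU].
move=> Dg Df; have Dg0 := CkW Dg; have Df0 := CkW Df.
case: Dg Df => [dg Dg] [df Df]; split=> [x Ux|v].
  by apply: (@differentiable_comp _ _ _ _ g f); [exact: dg|exact/df/gU].
have : Ck k U (fun x => \sum_j ('D_v g x) 0 j *: 'D_('e_j) f (g x)).
  apply: Ck_sum => // j _; apply: CkZ => //.
    by apply: Ck_coord => //; exact: Dg.
  exact: (IH _ _ Dg0 (Df _)).
apply: Ck_eq => // x Ux.
have dgx := dg _ Ux; have dfx := df _ (gU _ Ux).
rewrite [RHS](deriveE _ (differentiable_comp dgx dfx)) (diff_comp dgx dfx) /=.
rewrite -(deriveE _ (dg _ Ux)) [RHS](linear_rowE _ (linearP _)).
by apply: eq_bigr => j _; rewrite (deriveE _ dfx).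
Qed.

End CkRow.

(** * Smoothness at a point *)

(** Smoothness on some neighbourhood: unlike smoothness on a given set, it is
    stable under the operations below without any bookkeeping of open sets. *)
Definition smooth_at (R : realType) (V W : normedModType R) (f : V -> W)
  (x : V) : Prop := exists2 U, open_nbhs x U & Csmooth U f.

Lemma near_open (T : topologicalType) (P : T -> Prop) x : (\forall y \near x, P y) ->
  exists2 U, open_nbhs x U & forall y, U y -> P y.
Proof. by move=> /(@id (nbhs x P)); rewrite nbhsE => -[U oU UP]; exists U. Qed.


Section SmoothAt.
Variables (R : realType) (V W : normedModType R).
Implicit Types (U : set V) (f g : V -> W) (x : V).

Lemma Csmooth_smooth_at U f : open U ->
  Csmooth U f <-> forall x, U x -> smooth_at f x.
Proof.
move=> oU; split=> [Uf x Ux|H k]; first by exists U.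
by apply: Ck_glue => x /H[U' [oU' U'x] /(_ k) Uf]; exists U'.
Qed.

Lemma smooth_at_near f x : smooth_at f x -> \forall y \near x, smooth_at f y.
Proof.
move=> [U [oU Ux] Uf]; apply: filterS (open_near oU Ux) => y Uy.
by exists U.
Qed.

Lemma near_eq_smooth_at f g x : (\forall y \near x, f y = g y) ->
  smooth_at f x -> smooth_at g x.
Proof.
move=> /near_open[U' [oU' U'x] fg] [U [oU Ux] Uf].
exists (U `&` U'); first by split; [exact: openI|].
move=> k; apply: (@Ck_eq _ _ _ k _ f); first exact: openI.
  by move=> y [_ /fg].
by apply: Ck_sub (Uf k) => y [].
Qed.

Lemma smooth_at_differentiable f x : smooth_at f x -> differentiable f x.
Proof. by move=> [U [oU Ux] /(_ 1%N)[+ _]]; exact. Qed.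

Lemma smooth_at_continuous f x : smooth_at f x -> {for x, continuous f}.
Proof. by move=> [U [oU Ux] /(_ 0%N)]; exact. Qed.

Lemma smooth_at_deriv f x v : smooth_at f x -> smooth_at (fun y => 'D_v f y) x.
Proof.
move=> [U oU Uf]; exists U => // k.
by have [_ /(_ v)] := Uf k.+1.
Qed.

Lemma smooth_at_diff f x v : smooth_at f x -> smooth_at (fun y => 'd f y v) x.
Proof.
move=> fx; apply: near_eq_smooth_at (smooth_at_deriv v fx).
apply: filterS (smooth_at_near fx) => y /smooth_at_differentiable ?.
exact: deriveE.
Qed.

Lemma smooth_at_cst (a : W) x : smooth_at (fun _ : V => a) x.
Proof.
exists setT; first by split => //; exact: openT.
by move=> k; exact: Ck_cst.
Qed.

Lemma smooth_atD f g x : smooth_at f x -> smooth_at g x ->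
  smooth_at (fun y => f y + g y) x.
Proof.
move=> [U [oU Ux] Uf] [U' [oU' U'x] U'g]; have oI := openI oU oU'.
exists (U `&` U') => // k.
by apply: CkD => //; [apply: Ck_sub (Uf k)|apply: Ck_sub (U'g k)] => y [].
Qed.

Lemma smooth_at_sum (I : Type) (r : seq I) (P : pred I) (f : I -> V -> W) x :
  (forall i, P i -> smooth_at (f i) x) ->
  smooth_at (fun y => \sum_(i <- r | P i) f i y) x.
Proof.
move=> Hf; elim: r => [|i r IH].
  by apply: near_eq_smooth_at (smooth_at_cst 0 x); near=> y; rewrite big_nil.
have [Pi|Pi] := boolP (P i); last first.
  by apply: near_eq_smooth_at IH; near=> y; rewrite big_cons (negbTE Pi).
by apply: near_eq_smooth_at (smooth_atD (Hf i Pi) IH); near=> y; rewrite big_cons Pi.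
Unshelve. all: by end_near. Qed.

Lemma smooth_atZ (a : V -> R) f x : smooth_at a x -> smooth_at f x ->
  smooth_at (fun y => a y *: f y) x.
Proof.
move=> [U [oU Ux] Uf] [U' [oU' U'x] U'g]; have oI := openI oU oU'.
exists (U `&` U') => // k.
by apply: CkZ => //; [apply: Ck_sub (Uf k)|apply: Ck_sub (U'g k)] => y [].
Qed.

End SmoothAt.

Section SmoothAtCoord.
Variables (R : realType) (V : normedModType R).

Lemma smooth_atM (f g : V -> R) x : smooth_at f x -> smooth_at g x ->
  smooth_at (fun y => f y * g y) x.
Proof. exact: smooth_atZ. Qed.

Lemma smooth_atV (f : V -> R) x : f x != 0 -> smooth_at f x ->
  smooth_at (fun y => (f y)^-1) x.
Proof.
move=> fx0 fx; have : \forall y \near x, f y != 0.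
  have := smooth_at_continuous fx.
  by move=> /(_ [set r | r != 0]); apply; exact: open_neq.
move=> /near_open[U' [oU' U'x] f0]; case: fx => U [oU Ux] Uf.
have oI := openI oU oU'; exists (U `&` U') => // k.
apply: CkV => //; first by move=> y [_ /f0].
by apply: Ck_sub (Uf k) => y [].
Qed.

Lemma smooth_at_coord m n (f : V -> 'M[R]_(m, n)) i j x : smooth_at f x ->
  smooth_at (fun y => f y i j) x.
Proof. by move=> [U [oU Ux] Uf]; exists U => // k; exact: Ck_coord. Qed.

Lemma smooth_at_prod (I : Type) (r : seq I) (P : pred I) (f : I -> V -> R) x :
  (forall i, P i -> smooth_at (f i) x) ->
  smooth_at (fun y => \prod_(i <- r | P i) f i y) x.
Proof.
move=> Hf; elim: r => [|i r IH].
  by apply: near_eq_smooth_at (smooth_at_cst (1 : R) x); near=> y; rewrite big_nil.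
have [Pi|Pi] := boolP (P i); last first.
  by apply: near_eq_smooth_at IH; near=> y; rewrite big_cons (negbTE Pi).
by apply: near_eq_smooth_at (smooth_atM (Hf i Pi) IH); near=> y; rewrite big_cons Pi.
Unshelve. all: by end_near. Qed.

Lemma smooth_at_det n (A : V -> 'M[R]_n) x :
  (forall i j, smooth_at (fun y => A y i j) x) ->
  smooth_at (fun y => \det (A y)) x.
Proof.
move=> HA.
have : forall s : {perm 'I_n}, true ->
    smooth_at (fun y => (-1) ^+ s * \prod_i A y i (s i)) x.
  move=> s _; apply: smooth_atM; first exact: smooth_at_cst.
  by apply: smooth_at_prod => i _; exact: HA.
move=> /(smooth_at_sum (index_enum _)).
by apply: near_eq_smooth_at; near=> y.
Unshelve. all: by end_near. Qed.

Lemma smooth_at_row m (f : V -> 'rV[R]_m) x :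
  (forall j, smooth_at (fun y => f y 0 j) x) -> smooth_at f x.
Proof.
move=> Hf.
have : forall j, true -> smooth_at (fun y => f y 0 j *: 'e_j : 'rV[R]_m) x.
  by move=> j _; apply: smooth_atZ => //; exact: smooth_at_cst.
move=> /(smooth_at_sum (index_enum _)).
by apply: near_eq_smooth_at; near=> y; rewrite -row_sum_coord.
Unshelve. all: by end_near. Qed.

(** Cramer's rule: the entries of the inverse are cofactors divided by the determinant. *)
Lemma smooth_at_invmx n (A : V -> 'M[R]_n) i j x :
  (forall i j, smooth_at (fun y => A y i j) x) -> A x \in unitmx ->
  smooth_at (fun y => invmx (A y) i j) x.
Proof.
move=> HA; rewrite unitmxE unitfE => Ax.
have dA := smooth_at_det HA.
have : smooth_at (fun y => (\det (A y))^-1 * cofactor (A y) j i) x.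
  apply: smooth_atM; first exact: smooth_atV.
  apply: smooth_atM; first exact: smooth_at_cst.
  apply: smooth_at_det => k l; apply: near_eq_smooth_at (HA (lift j k) (lift i l)).
  by near=> y; rewrite !mxE.
apply: near_eq_smooth_at.
have : \forall y \near x, \det (A y) != 0.
  have := smooth_at_continuous dA.
  by move=> /(_ [set r | r != 0]); apply; exact: open_neq.
by apply: filterS => y Ay; rewrite /invmx unitmxE unitfE Ay !mxE.
Unshelve. all: by end_near. Qed.

Lemma smooth_at_comp m (W : normedModType R) (g : V -> 'rV[R]_m)
    (f : 'rV[R]_m -> W) x :
  smooth_at g x -> smooth_at f (g x) -> smooth_at (fun y => f (g y)) x.
Proof.
move=> gx [U' [oU' U'gx] Uf]; case: (gx) => U [oU Ux] Ug.
have Ux' : \forall y \near x, U y /\ U' (g y).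
  apply: filterI; first exact: open_near.
  have := smooth_at_continuous gx; apply.
  exact: open_nbhs_nbhs.
have [U2 [oU2 U2x] H] := near_open Ux'.
exists U2 => // k; apply: (Ck_comp (U' := U')) => //.
  by move=> y /H[].
by apply: Ck_sub (Ug k) => y /H[].
Qed.

Lemma deriv_comp m (W : normedModType R) (g : V -> 'rV[R]_m)
    (f : 'rV[R]_m -> W) x v :
  smooth_at g x -> smooth_at f (g x) ->
  'D_v (fun y => f (g y)) x = 'd f (g x) ('D_v g x).
Proof.
move=> /smooth_at_differentiable dg /smooth_at_differentiable df.
by rewrite [LHS](deriveE _ (differentiable_comp dg df)) (diff_comp dg df)/= deriveE.
Qed.

Lemma derivD (W : normedModType R) (f g : V -> W) x v :
  smooth_at f x -> smooth_at g x ->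
  'D_v (fun y => f y + g y) x = 'D_v f x + 'D_v g x.
Proof.
move=> /smooth_at_differentiable df /smooth_at_differentiable dg.
have dfx : derivable f x v by exact/diff_derivable.
have dgx : derivable g x v by exact/diff_derivable.
exact/(deriveD dfx dgx).
Qed.

Lemma deriv_sum (W : normedModType R) (I : Type) (r : seq I) (f : I -> V -> W) x v :
  (forall i, smooth_at (f i) x) ->
  'D_v (fun y => \sum_(i <- r) f i y) x = \sum_(i <- r) 'D_v (f i) x.
Proof.
move=> Hf; elim: r => [|i r IH].
  rewrite big_nil -[RHS](derive_cst (0 : W) x v); apply: near_eq_derive.
  by near=> y; rewrite big_nil.
rewrite big_cons -IH -derivD//; last by apply: smooth_at_sum => *.
by apply: near_eq_derive; near=> y; rewrite big_cons.
Unshelve. all: by end_near. Qed.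

Lemma derivZ (W : normedModType R) (a : V -> R) (f : V -> W) x v :
  smooth_at a x -> smooth_at f x ->
  'D_v (fun y => a y *: f y) x = a x *: 'D_v f x + 'D_v a x *: f x.
Proof.
move=> /smooth_at_differentiable da /smooth_at_differentiable df.
exact: deriv_scale.
Qed.

End SmoothAtCoord.

(** * Smooth families of linear maps *)

Section SmoothFamily.
Variables (R : realType) (V : normedModType R).

Lemma near_preimage m (g : V -> 'rV[R]_m) (P : 'rV[R]_m -> Prop) x :
  smooth_at g x -> (\forall z \near g x, P z) -> \forall y \near x, P (g y).
Proof. by move=> /smooth_at_continuous cg Pg; exact: (cg _ Pg). Qed.

(** The chain rule for a map h which is only near x the composite f o g; changes
    of charts always appear in this form. *)
Lemma diff_chain m (W : normedModType R) (g : V -> 'rV[R]_m)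
    (f : 'rV[R]_m -> W) (h : V -> W) x y v :
  smooth_at g x -> g x = y -> smooth_at f y ->
  (\forall z \near x, f (g z) = h z) -> 'd h x v = 'd f y ('d g x v).
Proof.
move=> gx <- fx E.
have dg := smooth_at_differentiable gx; have df := smooth_at_differentiable fx.
have dfg : differentiable (fun z => f (g z)) x by exact: differentiable_comp.
rewrite -(near_eq_diff E dfg).
have := diff_comp dg df => /(congr1 (fun F => F v)) /=.
exact.
Qed.

Lemma smooth_at_chain m (W : normedModType R) (g : V -> 'rV[R]_m)
    (f : 'rV[R]_m -> W) (h : V -> W) x y :
  smooth_at g x -> g x = y -> smooth_at f y ->
  (\forall z \near x, f (g z) = h z) -> smooth_at h x.
Proof. by move=> gx <- fx E; exact: near_eq_smooth_at E (smooth_at_comp gx fx). Qed.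

(** Components of tensor fields are families of linear maps A z that are smooth
    in z for each fixed argument; linearity turns this into joint smoothness, since
    A z u is the sum of the u_j A z e_j. Linearity is required only near y x
    because Christoffel symbols are linear only over the domain of a chart. *)
Lemma smooth_at_family a m (W : normedModType R) (A : 'rV[R]_a -> 'rV[R]_m -> W)
    (y : V -> 'rV[R]_a) (u : V -> 'rV[R]_m) x :
  (\forall z \near y x, linear (A z)) -> (forall w, smooth_at (A^~ w) (y x)) ->
  smooth_at y x -> smooth_at u x -> smooth_at (fun z => A (y z) (u z)) x.
Proof.
move=> lA sA sy su.
have : smooth_at (fun z => \sum_j u z 0 j *: A (y z) 'e_j) x.
  apply: smooth_at_sum => j _; apply: smooth_atZ; first exact: (smooth_at_coord 0 j su).
  exact: (smooth_at_comp sy (sA _)).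
apply: near_eq_smooth_at.
apply: filterS (near_preimage sy lA) => z lAz.
by rewrite -linear_rowE.
Qed.

Lemma deriv_family a m (W : normedModType R) (A : 'rV[R]_a -> 'rV[R]_m -> W)
    (y : V -> 'rV[R]_a) (u : V -> 'rV[R]_m) x h :
  (\forall z \near y x, linear (A z)) -> (forall w, smooth_at (A^~ w) (y x)) ->
  smooth_at y x -> smooth_at u x ->
  'D_h (fun z => A (y z) (u z)) x =
  'd (A^~ (u x)) (y x) ('D_h y x) + A (y x) ('D_h u x).
Proof.
move=> lA sA sy su.
have su' j := smooth_at_coord 0 j su.
have sA' j := smooth_at_comp sy (sA 'e_j).
have lAx := nbhs_singleton lA.
transitivity ('D_h (fun z => \sum_j u z 0 j *: A (y z) 'e_j) x).
  apply: near_eq_derive.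
  apply: filterS (near_preimage sy lA) => z lAz.
  by rewrite -linear_rowE.
rewrite deriv_sum; last by move=> j; exact: smooth_atZ.
under eq_bigr do rewrite derivZ//.
rewrite big_split/=; congr (_ + _); last first.
  rewrite [RHS](linear_rowE _ lAx); apply: eq_bigr => j _; congr (_ *: _).
  by rewrite deriv_coord//; exact: smooth_at_differentiable.
rewrite -deriveE; last exact: smooth_at_differentiable.
transitivity ('D_('D_h y x) (fun z => \sum_j u x 0 j *: A z 'e_j) (y x)); last first.
  by apply: near_eq_derive; apply: filterS lA => z lAz; rewrite -linear_rowE.
have sc j : smooth_at (fun=> u x 0 j : R) (y x) by exact: smooth_at_cst.
rewrite deriv_sum; last by move=> j; exact: smooth_atZ (sc j) (sA _).
apply: eq_bigr => j _; rewrite (derivZ _ (sc j) (sA _)).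
rewrite derive_cst scale0r addr0; congr (_ *: _).
rewrite (deriv_comp _ sy (sA _)).
by apply/esym; apply: deriveE; exact: smooth_at_differentiable (sA _).
Qed.

End SmoothFamily.

Section SmoothBilinearFamily.
Variable R : realType.

Lemma smooth_at_id a (x : 'rV[R]_a) : smooth_at (fun z : 'rV[R]_a => z) x.
Proof.
apply: smooth_at_row => j.
exists setT; first by split => //; exact: openT.
case=> [|k]; first by move=> y _; exact: coord_continuous.
split=> [y _|v]; first exact: differentiable_coord.
have c : 'D_v (fun y : 'rV[R]_a => y 0 j) = fun=> v 0 j.
  by apply/funext => y; rewrite deriv_coord// derive_id.
by rewrite -/(derive _ ^~ v) c; exact: Ck_cst.
Qed.

Lemma smooth_at_family2 a b k l (W : normedModType R)
    (A : 'rV[R]_b -> 'rV[R]_k -> 'rV[R]_l -> W)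
    (y : 'rV[R]_a -> 'rV[R]_b) (u : 'rV[R]_a -> 'rV[R]_k) (v : 'rV[R]_a -> 'rV[R]_l) x :
  (\forall z \near y x, forall w, linear (fun w' => A z w' w)) ->
  (\forall z \near y x, forall w, linear (A z w)) ->
  (forall w w', smooth_at (fun z => A z w w') (y x)) ->
  smooth_at y x -> smooth_at u x -> smooth_at v x ->
  smooth_at (fun z => A (y z) (u z) (v z)) x.
Proof.
move=> lA lA' sA sy su sv.
apply: (smooth_at_family (A := fun z w => A (y z) w (v z)) (y := id)) => //.
- by apply: filterS (near_preimage sy lA) => z.
- move=> w; apply: (smooth_at_family (A := fun z => A z w)) => //.
  by apply: filterS lA' => z.
- exact: smooth_at_id.
Qed.

Lemma deriv_family2 a b k l (W : normedModType R)
    (A : 'rV[R]_b -> 'rV[R]_k -> 'rV[R]_l -> W)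
    (y : 'rV[R]_a -> 'rV[R]_b) (u : 'rV[R]_a -> 'rV[R]_k) (v : 'rV[R]_a -> 'rV[R]_l) x h :
  (\forall z \near y x, forall w, linear (fun w' => A z w' w)) ->
  (\forall z \near y x, forall w, linear (A z w)) ->
  (forall w w', smooth_at (fun z => A z w w') (y x)) ->
  smooth_at y x -> smooth_at u x -> smooth_at v x ->
  'D_h (fun z => A (y z) (u z) (v z)) x =
  'd (fun z => A z (u x) (v x)) (y x) ('D_h y x)
  + A (y x) (u x) ('D_h v x) + A (y x) ('D_h u x) (v x).
Proof.
move=> lA lA' sA sy su sv.
have lA1 w : \forall z \near y x, linear (A z w) by apply: filterS lA' => z.
have sB w : smooth_at (fun z => A (y z) w (v z)) x.
  by apply: (smooth_at_family (A := fun z => A z w)).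
have lB : \forall z \near x, linear (fun w => A (y z) w (v z)).
  by apply: filterS (near_preimage sy lA) => z.
have := deriv_family h (A := fun z w => A (y z) w (v z)) (y := id) lB sB (smooth_at_id x) su.
move=> ->; congr (_ + _).
rewrite derive_id -deriveE; last exact: smooth_at_differentiable.
exact: (deriv_family h (A := fun z => A z (u x))).
Qed.

End SmoothBilinearFamily.

Section DiffRules.
Variables (R : realType) (V W : normedModType R).

Lemma diffD_val (f g : V -> W) x v : smooth_at f x -> smooth_at g x ->
  'd (fun y => f y + g y) x v = 'd f x v + 'd g x v.
Proof.
move=> /smooth_at_differentiable df /smooth_at_differentiable dg.
exact: (congr1 (fun F => F v) (diffD df dg)).
Qed.

Lemma diffZ_val (a : V -> R) (f : V -> W) x v : smooth_at a x -> smooth_at f x ->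
  'd (fun y => a y *: f y) x v = a x *: 'd f x v + 'd a x v *: f x.
Proof.
move=> /smooth_at_differentiable da /smooth_at_differentiable df.
have da' : is_diff x a ('d a x) by exact: DiffDef.
have df' : is_diff x f ('d f x) by exact: DiffDef.
have [_ E] := is_diff_scale da' df'.
exact: (congr1 (fun F => F v) E).
Qed.

End DiffRules.

(** * Symmetry of second derivatives *)

Section Schwarz.
Variables (R : realType) (V : normedModType R).
Implicit Types (f : V -> R) (x u v : V).

Lemma mvt_line f p w (t : R) : 0 < t ->
  (forall s, 0 <= s <= t -> differentiable f (p + s *: w)) ->
  exists2 c, 0 <= c <= t & f (p + t *: w) - f p = t * 'D_w f (p + c *: w).
Proof.
move=> t0 df; pose h (s : R) := f (p + s *: w).
have hd s : 0 <= s <= t -> is_diff s h (fun r => 'd f (p + s *: w) (r *: w)).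
  move=> /df dfs.
  have l : is_diff s (fun r : R => p + r *: w) (fun r : R => r *: w).
    have := is_diffD (is_diff_cst p s) (is_diff_scalel s w).
    by rewrite add0r.
  have F : is_diff (p + s *: w) f ('d f (p + s *: w)) by exact: DiffDef.
  exact: (@is_diff_comp _ _ _ _ _ _ _ _ s l F).
have [] := @MVT R h (fun s => 'D_w f (p + s *: w)) 0 t t0.
- move=> s; rewrite in_itv/= => /andP[s0 st].
  have s0t : 0 <= s <= t by rewrite !ltW.
  have [dh Eh] := hd s s0t; apply: DeriveDef; first exact: diff_derivable.
  by rewrite deriveE// Eh scale1r deriveE//; exact: df.
- apply: continuous_in_subspaceT => s; rewrite inE/= in_itv/= => /hd[dh _].
  exact: differentiable_continuous.
move=> c; rewrite in_itv/= => /andP[c0 ct] E; exists c; first by rewrite !ltW.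
by move: E; rewrite /h scale0r addr0 subr0 mulrC.
Qed.

(** The mean value theorem applied twice, first in the direction u to the
    difference f (y + t v) - f y, then in the direction v. The second difference is
    symmetric in u and v, which is what makes the theorem of Schwarz work. *)
Lemma second_difference f x u v (t : R) : 0 < t ->
  (forall s s', 0 <= s <= t -> 0 <= s' <= t -> smooth_at f (x + s *: u + s' *: v)) ->
  exists s s', [/\ 0 <= s <= t, 0 <= s' <= t &
   f (x + t *: u + t *: v) - f (x + t *: u) - f (x + t *: v) + f x =
   t * t * 'D_v (fun y => 'D_u f y) (x + s *: u + s' *: v)].
Proof.
move=> t0 sf; have tt : 0 <= t <= t by rewrite lexx ltW.
have t00 : (0 : R) <= 0 <= t by rewrite lexx ltW.
have sf0 s : 0 <= s <= t -> smooth_at f (x + s *: u).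
  by move=> /sf /(_ t00); rewrite scale0r addr0.
pose g y := f (y + t *: v) - f y.
have shd y : is_diff y (fun z : V => z + t *: v) id.
  have := is_diffD (is_diff_id y) (is_diff_cst (t *: v) y).
  by rewrite addr0.
have gd s : 0 <= s <= t -> is_diff (x + s *: u) g
   ('d f (x + s *: u + t *: v) \- 'd f (x + s *: u)).
  move=> st; have F1 : is_diff (x + s *: u) f ('d f (x + s *: u)).
    by apply: DiffDef => //; exact/smooth_at_differentiable/sf0.
  have F2 : is_diff (x + s *: u + t *: v) f ('d f (x + s *: u + t *: v)).
    by apply: DiffDef => //; exact/smooth_at_differentiable/sf.
  have := is_diffB (@is_diff_comp _ _ _ _ _ _ _ _ _ (shd _) F2) F1.
  exact.
have [s|s st E] := @mvt_line g x u t t0; first by move=> /gd[].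
have [s'|s' st' E'] := @mvt_line (fun y => 'D_u f y) (x + s *: u) v t t0.
  by move=> st'; apply/smooth_at_differentiable/smooth_at_deriv/sf.
exists s, s'; split => //.
rewrite -mulrA -E'.
have dg : 'D_u g (x + s *: u) = 'D_u f (x + s *: u + t *: v) - 'D_u f (x + s *: u).
  have [dg Eg] := gd s st; rewrite deriveE// Eg /=.
  by rewrite !deriveE//; apply/smooth_at_differentiable; [exact: sf0|exact: sf].
by rewrite -dg -E /g [x + t *: v]addrC opprB !addrA addrAC [t *: v + x]addrC.
Qed.

(** Both mixed derivatives are limits, as t tends to 0, of the second difference
    divided by t^2. *)
Lemma schwarz_real f x u v : smooth_at f x ->
  'D_u (fun y => 'D_v f y) x = 'D_v (fun y => 'D_u f y) x.
Proof.
move=> fx.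
(* naming the mixed derivatives keeps the limits that define them folded *)
have [A EA] : exists A : V -> R, forall y, A y = 'D_u (fun y => 'D_v f y) y
  := ex_intro _ _ (fun=> erefl).
have [B EB] : exists B : V -> R, forall y, B y = 'D_v (fun y => 'D_u f y) y
  := ex_intro _ _ (fun=> erefl).
rewrite -EA -EB.
have cA : {for x, continuous A}.
  rewrite (funext EA); exact/smooth_at_continuous/smooth_at_deriv/smooth_at_deriv.
have cB : {for x, continuous B}.
  rewrite (funext EB); exact/smooth_at_continuous/smooth_at_deriv/smooth_at_deriv.
apply/eqP; rewrite -subr_eq0 -normr_le0; apply/ler_addgt0Pl => e e0; rewrite addr0.
have e2 : 0 < e / 2 by rewrite divr_gt0.
have hA : \forall y \near x, `|A x - A y| < e / 2.
  by move/cvgrPdist_lt : cA; exact.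
have hB : \forall y \near x, `|B x - B y| < e / 2.
  by move/cvgrPdist_lt : cB; exact.
have {}fx := smooth_at_near fx.
have : \forall y \near x, [/\ smooth_at f y, `|A x - A y| < e / 2
    & `|B x - B y| < e / 2].
  by move: fx hA hB; apply: filterS3 => y *; split.
move=> /nbhs_normP[r /= r0 Hr].
(* with this step the parallelogram spanned by t u and t v at x stays in the ball
   of radius r *)
pose t := r / (`|u| + `|v| + 1).
have d0 : 0 < `|u| + `|v| + 1 by rewrite ltr_wpDl// addr_ge0.
have t0 : 0 < t by rewrite divr_gt0.
have inball s s' : 0 <= s <= t -> 0 <= s' <= t ->
    `|x - (x + s *: u + s' *: v)| < r.
  move=> /andP[s0 st] /andP[s'0 s't].
  rewrite -addrA opprD addrA subrr add0r normrN.
  rewrite (le_lt_trans (ler_normD _ _))// !normrZ !ger0_norm//.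
  rewrite (@le_lt_trans _ _ (t * (`|u| + `|v|)))//.
    by rewrite mulrDr lerD// ler_wpM2r.
  by rewrite /t mulrAC ltr_pdivrMr// ltr_pM2l// ltrDl.
have [s [s' [hs hs' ]]] := @second_difference f x u v t t0
  (fun s s' hs hs' => let: And3 H _ _ := Hr _ (inball s s' hs hs') in H).
rewrite -EB => E.
have inball' s1 s1' : 0 <= s1 <= t -> 0 <= s1' <= t ->
    `|x - (x + s1 *: v + s1' *: u)| < r.
  by move=> h h'; rewrite addrAC; exact: inball.
have [s1 [s1' [hs1 hs1' ]]] := @second_difference f x v u t t0
  (fun s s' hs hs' => let: And3 H _ _ := Hr _ (inball' s s' hs hs') in H).
rewrite -EA => E'.
have EAB : B (x + s *: u + s' *: v) = A (x + s1 *: v + s1' *: u).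
  have tt : t * t != 0 by rewrite mulf_neq0// gt_eqF.
  apply: (mulfI tt); rewrite -E -E' [x + t *: v + _]addrAC.
  by congr (_ + _); rewrite -!addrA; congr (_ + _); rewrite addrC.
have [_ _ h2] := Hr _ (inball _ _ hs hs').
have [_ h1 _] := Hr _ (inball' _ _ hs1 hs1').
rewrite EAB in h2.
rewrite -(subrKA (A (x + s1 *: v + s1' *: u))) [e]splitr.
by rewrite (le_trans (ler_normD _ _))// lerD// ltW// distrC.
Qed.

End Schwarz.

Section Bracket.
Variable R : realType.

Lemma schwarz a m (f : 'rV[R]_a -> 'rV[R]_m) x u v : smooth_at f x ->
  'D_u (fun y => 'D_v f y) x = 'D_v (fun y => 'D_u f y) x.
Proof.
move=> fx; apply/rowP => j.
have sw w z : smooth_at f x -> ('D_w (fun y => 'D_z f y) x) 0 j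
    = 'D_w (fun y => 'D_z (fun y' => f y' 0 j) y) x.
  move=> _; rewrite -deriv_coord; last first.
    exact/smooth_at_differentiable/smooth_at_deriv.
  apply: near_eq_derive; apply: filterS (smooth_at_near fx) => y fy.
  by rewrite deriv_coord//; exact/smooth_at_differentiable.
apply: etrans (sw u v fx) (etrans _ (esym (sw v u fx))).
exact: schwarz_real (smooth_at_coord 0 j fx).
Qed.

Lemma smooth_at_diff_field (W : normedModType R) a b (f : 'rV[R]_b -> W)
    (y : 'rV[R]_a -> 'rV[R]_b) (X : 'rV[R]_a -> 'rV[R]_b) x :
  smooth_at f (y x) -> smooth_at y x -> smooth_at X x ->
  smooth_at (fun z => 'd f (y z) (X z)) x.
Proof.
move=> fx yx Xx; apply: (smooth_at_family (A := fun z w => 'd f z w)) => //.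
  by near=> z; exact: linearP.
by move=> w; exact: smooth_at_diff.
Unshelve. all: by end_near. Qed.

(** The terms with the second derivative of f cancel. Applied to a function, this
    says that the bracket of two fields acts as their commutator; applied to an
    immersion, that the immersion relates brackets. *)
Lemma diff_bracket (W : normedModType R) a (f : 'rV[R]_a -> W) (X Y : 'rV[R]_a -> 'rV[R]_a) x :
  (forall u v, 'D_u (fun y => 'D_v f y) x = 'D_v (fun y => 'D_u f y) x) ->
  smooth_at f x -> smooth_at X x -> smooth_at Y x ->
  'D_(X x) (fun z => 'd f z (Y z)) x - 'D_(Y x) (fun z => 'd f z (X z)) x =
  'd f x ('D_(X x) Y x - 'D_(Y x) X x).
Proof.
move=> sch fx Xx Yx.
have lf : \forall z \near x, linear ('d f z) by near=> z; exact: linearP.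
have sf w : smooth_at (fun z => 'd f z w) x by exact: smooth_at_diff.
have E u v : 'd (fun z => 'd f z u) x v = 'D_v (fun y => 'D_u f y) x.
  rewrite -deriveE; last exact/smooth_at_differentiable.
  apply: near_eq_derive; apply: filterS (smooth_at_near fx) => y fy.
  by rewrite deriveE//; exact/smooth_at_differentiable.
have sid := smooth_at_id x.
have F := @deriv_family _ _ a a W (fun z w => 'd f z w) (fun z => z).
have FE (U : 'rV[R]_a -> 'rV[R]_a) h : smooth_at U x ->
    'D_h (fun z => 'd f z (U z)) x =
    'D_h (fun y => 'D_(U x) f y) x + 'd f x ('D_h U x).
  move=> Ux; apply: etrans (F U x h lf sf sid Ux) _.
  by rewrite derive_id; congr (_ + _); exact: E.
rewrite (FE Y (X x) Yx) (FE X (Y x) Xx) linearB opprD addrACA.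
by rewrite -[RHS]add0r; congr (_ + _); apply/eqP; rewrite subr_eq0; apply/eqP.
Unshelve. all: by end_near. Qed.

End Bracket.

(** * Lorentzian and positive definite bilinear forms *)

Section BilinearForms.
Variables (R : realType) (n : nat).
Implicit Types (b : 'rV[R]_n -> 'rV[R]_n -> R) (u v w : 'rV[R]_n).

Definition bilin b := forall v, scalar (b v) /\ scalar (fun w => b w v).

Definition nondeg b := forall v, (forall w, b v w = 0) -> v = 0.

Definition gram b : 'M[R]_n := \matrix_(i, j) b 'e_i 'e_j.

Lemma scalar_rowE (l : 'rV[R]_n -> R) v : scalar l -> l v = \sum_j v 0 j * l 'e_j.
Proof.
move=> hl; pose lm := GRing.isLinear.Build _ _ _ _ _ hl.
pose L : {scalar _} := HB.pack l lm.
have -> : l = L by [].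
rewrite [in LHS](row_sum_delta v) linear_sum; apply: eq_bigr => j _.
by rewrite linearZ.
Qed.

Lemma bilinDl b u v w : bilin b -> b (u + v) w = b u w + b v w.
Proof. by move=> /(_ w)[_ /(_ 1 u v)]; rewrite scale1r mul1r. Qed.

Lemma bilinDr b u v w : bilin b -> b w (u + v) = b w u + b w v.
Proof. by move=> /(_ w)[/(_ 1 u v) + _]; rewrite scale1r mul1r. Qed.

Lemma bilin0l b w : bilin b -> b 0 w = 0.
Proof. by move=> /(_ w)[_ /(_ (-1) 0 0)]; rewrite scaler0 addr0 mulN1r addNr. Qed.

Lemma bilin0r b w : bilin b -> b w 0 = 0.
Proof. by move=> /(_ w)[/(_ (-1) 0 0) + _]; rewrite scaler0 addr0 mulN1r addNr. Qed.

Lemma bilinZl b a u w : bilin b -> b (a *: u) w = a * b u w.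
Proof. by move=> hb; have [_ /(_ a u 0)] := hb w; rewrite addr0 bilin0l// addr0. Qed.

Lemma bilinZr b a u w : bilin b -> b w (a *: u) = a * b w u.
Proof. by move=> hb; have [/(_ a u 0) + _] := hb w; rewrite addr0 bilin0r// addr0. Qed.

Lemma gram_mulmx b v j : bilin b -> (v *m gram b) 0 j = b v 'e_j.
Proof.
move=> hb; rewrite mxE (scalar_rowE v (proj2 (hb 'e_j))).
by apply: eq_bigr => k _; rewrite mxE.
Qed.

Lemma gramE b v w : bilin b -> b v w = (v *m gram b *m w^T) 0 0.
Proof.
move=> hb; rewrite mxE (scalar_rowE w (proj1 (hb v))).
by apply: eq_bigr => k _; rewrite gram_mulmx// mxE mulrC.
Qed.

Lemma nondeg_gram b : bilin b -> nondeg b -> gram b \in unitmx.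
Proof.
move=> hb nb; rewrite -row_free_unit; apply: inj_row_free => v v0.
by apply: nb => w; rewrite gramE// v0 mul0mx mxE.
Qed.

Lemma nondeg_represent b (l : 'rV[R]_n -> R) : bilin b -> nondeg b -> scalar l ->
  exists w, forall z, b w z = l z.
Proof.
move=> hb nb hl; have U := nondeg_gram hb nb.
exists ((\row_j l 'e_j) *m invmx (gram b)) => z.
rewrite gramE// mulmxKV// mxE (scalar_rowE z hl).
by apply: eq_bigr => j _; rewrite !mxE mulrC.
Qed.

(** Gram-Schmidt: the rows of A are orthonormal for H and contain u. While there
    are fewer than n of them, the space orthogonal to them is nonzero, and a
    normalised vector of that space is added. *)
Lemma orthonormal_extend (H : 'M[R]_n) (u : 'rV[R]_n) m k (A : 'M[R]_(k, n)) :
  H^T = H -> (forall v : 'rV[R]_n, v != 0 -> 0 < (v *m H *m v^T) 0 0) ->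
  (k + m)%N = n -> A *m H *m A^T = 1%:M -> (exists i, row i A = u) ->
  exists2 B : 'M[R]_n, B *m H *m B^T = 1%:M & exists i, row i B = u.
Proof.
move=> Hs Hp; elim: m k A => [|m IH] k A.
  by rewrite addn0 => kn; move: A; rewrite kn => A; exists A.
rewrite addnS -addSn => kn AHA [i Ai].
have [v v0 vA] : exists2 v : 'rV[R]_n, v != 0 & v *m (H *m A^T) = 0.
  have : kermx (H *m A^T) != 0.
    rewrite -mxrank_eq0 mxrank_ker subn_eq0 -ltnNge.
    by rewrite (leq_ltn_trans (rank_leq_col _))// -kn ltnS leq_addr.
  by move=> /rowV0Pn[v /sub_kermxP vA v0]; exists v.
have vp := Hp v v0; set q := (v *m H *m v^T) 0 0 in vp.
pose v' := (Num.sqrt q)^-1 *: v.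
have v'v' : v' *m H *m v'^T = 1%:M.
  apply/matrixP => i1 j1; rewrite !ord1 [RHS]mxE eqxx /v'.
  rewrite linearZ/= -scalemxAr -!scalemxAl scalerA mxE -/q -expr2 exprVn sqr_sqrtr ?ltW//.
  by rewrite mulVf ?gt_eqF.
have v'A : v' *m H *m A^T = 0 by rewrite /v' -!scalemxAl -mulmxA vA scaler0.
have Av' : A *m H *m v'^T = 0.
  by apply: trmx_inj; rewrite trmx0 !trmx_mul trmxK Hs mulmxA v'A.
apply: (IH (1 + k)%N (col_mx v' A)) => //.
  rewrite mul_col_mx tr_col_mx mul_col_row v'v' v'A Av' AHA.
  by rewrite -scalar_mx_block.
by exists (rshift 1 i); rewrite rowKd.
Qed.

(** Split v into a multiple of xi and a vector w orthogonal to xi: the left-hand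
    side is b w w + (b v xi)^2, and b is positive definite on the orthogonal
    of xi. *)
Lemma lorentzian_posdef b xi : bilin b -> (forall v w, b v w = b w v) ->
  lorentzian_form b -> b xi xi = -1 ->
  forall v, v != 0 -> 0 < b v v + 2 * b v xi ^+ 2.
Proof.
move=> hb bs [i0 [P [Pu bP]]] bxi.
pose co v := v *m invmx P.
have bE v w : b v w = (\sum_(i | i != i0) co v 0 i * co w 0 i) - co v 0 i0 * co w 0 i0.
  have rE x : x = \sum_i co x 0 i *: row i P.
    by rewrite -mulmx_sum_row mulmxKV.
  have L1 (r : seq 'I_n) f x : b (\sum_(i <- r) f i *: row i P) x =
      \sum_(i <- r) f i * b (row i P) x.
    elim: r => [|i r IH]; first by rewrite !big_nil bilin0l.
    by rewrite !big_cons bilinDl// bilinZl// IH.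
  have L2 (r : seq 'I_n) f x : b x (\sum_(i <- r) f i *: row i P) =
      \sum_(i <- r) f i * b x (row i P).
    elim: r => [|i r IH]; first by rewrite !big_nil bilin0r.
    by rewrite !big_cons bilinDr// bilinZr// IH.
  rewrite [in LHS](rE v) L1.
  have L3 i : b (row i P) w = co w 0 i * (if i == i0 then -1 else 1).
    rewrite (rE w) L2 (bigD1 i)//= bP eqxx big1 ?addr0//.
      by rewrite -rE.
    by move=> j ji; rewrite bP eq_sym (negbTE ji) mulr0.
  under eq_bigr do rewrite L3.
  rewrite (bigD1 i0)//= eqxx mulrN1 mulrN addrC; congr (_ - _).
  by apply: eq_bigr => i /negbTE ->; rewrite mulr1.
move=> v v0; set s := b v xi.
have [w wE] : exists w, w = v + s *: xi by eexists.
have wxi : b w xi = 0 by rewrite wE bilinDl// bilinZl// bxi mulrN1 subrr.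
have vE : v = w + (- s) *: xi by rewrite wE scaleNr addrK.
have bvv : b v v = b w w - s ^+ 2.
  rewrite {1 2}vE bilinDl// !bilinDr// !bilinZl// !bilinZr// (bs xi w) wxi bxi.
  ring.
pose a0 := co xi 0 i0; pose w0 := co w 0 i0.
(* a quantitative Cauchy-Schwarz inequality, from b w xi = 0 and b xi xi = -1 *)
have sum_of_squares : a0 ^+ 2 * b w w =
    w0 ^+ 2 + \sum_(i | i != i0) (a0 * co w 0 i - w0 * co xi 0 i) ^+ 2.
  have S : \sum_(i | i != i0) (a0 * co w 0 i - w0 * co xi 0 i) ^+ 2 =
     a0 ^+ 2 * (\sum_(i | i != i0) co w 0 i * co w 0 i)
     - 2 * a0 * w0 * (\sum_(i | i != i0) co w 0 i * co xi 0 i)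
     + w0 ^+ 2 * (\sum_(i | i != i0) co xi 0 i * co xi 0 i).
    rewrite !mulr_sumr -sumrB -big_split/=; apply: eq_bigr => i _; ring.
  have := bE w w; have := bE w xi; have := bE xi xi.
  rewrite S bxi wxi -/a0 -/w0 => E1 E2 E3.
  set X := \sum_(i | _) _ in E3 *; set Z := \sum_(i | _) _ in E2 *.
  set Y := \sum_(i | _) _ in E1 *.
  have -> : Z = w0 * a0 by lra.
  have -> : Y = a0 * a0 - 1 by lra.
  rewrite E3; ring.
have a0p : 0 < a0 ^+ 2.
  have := bE xi xi; rewrite bxi -/a0 => E1.
  have : 0 <= \sum_(i | i != i0) co xi 0 i * co xi 0 i.
    by apply: sumr_ge0 => i _; rewrite -expr2 sqr_ge0.
  rewrite expr2; lra.
have Sp : 0 <= \sum_(i | i != i0) (a0 * co w 0 i - w0 * co xi 0 i) ^+ 2.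
  by apply: sumr_ge0 => i _; exact: sqr_ge0.
have bw : 0 <= b w w.
  by rewrite -(pmulr_rge0 _ a0p) sum_of_squares addr_ge0// sqr_ge0.
rewrite bvv -/s (_ : _ + _ = b w w + s ^+ 2); last by ring.
have [w00|wn0] := eqVneq w 0.
  have s0 : s != 0.
    by apply: contra_neq v0 => s0; rewrite vE w00 s0 oppr0 scale0r addr0.
  by rewrite ltr_wpDl// exprn_even_gt0.
suff bwn : b w w != 0 by rewrite ltr_pwDl ?sqr_ge0// lt_def bwn.
apply: contra_neq wn0 => bw0.
move: sum_of_squares; rewrite bw0 mulr0 => /esym/eqP.
rewrite paddr_eq0 ?sqr_ge0// sqrf_eq0 => /andP[/eqP w00 S0].
have a00 : a0 != 0 by rewrite -sqrf_eq0 gt_eqF.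
have cw : co w = 0.
  apply/rowP => i; rewrite [RHS]mxE; have [->//|ii0] := eqVneq i i0.
  move: S0; rewrite psumr_eq0 => [/allP/(_ i)|j _]; last exact: sqr_ge0.
  rewrite mem_index_enum ii0 => /(_ isT)/=.
  by rewrite sqrf_eq0 w00 mul0r subr0 mulf_eq0 (negbTE a00)/= => /eqP.
by rewrite -(mulmxKV Pu w) -/(co w) cw mul0mx.
Qed.

(** Complete u to an orthonormal basis for the positive definite form
    h = b + 2 b(., u) b(., u). For b this basis is pseudo-orthonormal with u
    timelike, because b(v, u) = - h(v, u). *)
Lemma posdef_lorentzian b u : bilin b -> (forall v w, b v w = b w v) ->
  b u u = -1 -> (forall v, v != 0 -> 0 < b v v + 2 * b v u ^+ 2) ->
  lorentzian_form b.
Proof.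
move=> hb bs buu hp.
pose h v w := b v w + 2 * (b v u * b w u).
have hh : bilin h.
  move=> v; split=> a x y; rewrite /h.
    rewrite bilinDr// bilinZr// bilinDl// bilinZl//; ring.
  rewrite !bilinDl// !bilinZl//; ring.
have hs v w : h v w = h w v by rewrite /h bs; ring.
have hu v : h v u = - b v u by rewrite /h buu; ring.
have H1 : (gram h)^T = gram h by apply/matrixP => i j; rewrite !mxE hs.
have H2 (v : 'rV[R]_n) : v != 0 -> 0 < (v *m gram h *m v^T) 0 0.
  by move=> /hp; rewrite -gramE// /h -expr2.
have u0 : u != 0.
  by apply/eqP => u0; move: buu; rewrite u0 bilin0l// => /esym/eqP; rewrite oppr_eq0 oner_eq0.
have n0 : (1 + n.-1)%N = n.
  have pos m (x : 'rV[R]_m) : x != 0 -> (1 + m.-1)%N = m.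
    by case: m x => // x; rewrite (thinmx0 x) eqxx.
  exact: pos u0.
have [||B BB [i0 Bi0]] := @orthonormal_extend (gram h) u _ 1 u H1 H2 n0.
- by apply/matrixP => i j; rewrite !ord1 -gramE// hu buu opprK !mxE eqxx.
- by exists 0; apply/rowP => j; rewrite mxE.
have hB i j : h (row i B) (row j B) = (i == j)%:R.
  have := congr1 (fun A : 'M[R]_n => A i j) BB; rewrite [X in _ = X]mxE => <-.
  rewrite gramE// -(row_mul i B).
  rewrite [LHS]mxE [RHS]mxE; apply: eq_bigr => k _.
  by rewrite !mxE.
exists i0, B; split.
  by have [] := mulmx1_unit BB => /[!unitmx_mul] /andP[].
move=> i j; have := hB i j; rewrite /h.
have -> : b (row i B) u = - (i == i0)%:R by rewrite -hB -Bi0 Bi0 hu opprK.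
have -> : b (row j B) u = - (j == i0)%:R by rewrite -hB -Bi0 Bi0 hu opprK.
have [->|ij] := eqVneq i j.
  by case: eqVneq => _ /=; lra.
have [ii0|_] := eqVneq i i0; have [ji0|_] := eqVneq j i0 => /=;
  rewrite ?mulr0n ?mulr1n; try lra.
by rewrite ii0 ji0 eqxx in ij.
Qed.

Lemma posdef_nondeg b u : bilin b ->
  (forall v, v != 0 -> 0 < b v v + 2 * b v u ^+ 2) -> nondeg b.
Proof.
move=> hb hp v bv0; apply/eqP/negPn/negP => /hp.
by rewrite !bv0 expr0n/= mulr0 addr0 ltxx.
Qed.

End BilinearForms.

(** * Functions and vector fields read in charts *)

Section Charts.
Variables (R : realType) (n : nat) (M : manifold R n).
Implicit Types (c d e : chart R n M) (p q : M).

(** Statements near p on the manifold become statements near its coordinates; the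
    points param c x provided by this lemma lie in the domain of c. *)
Lemma near_chart c p (P : M -> Prop) : dom c p -> (\forall q \near p, P q) ->
  \forall x \near coord c p,
    [/\ dom c (param c x), coord c (param c x) = x & P (param c x)].
Proof.
move=> cp Pp; have im : (coord c @` dom c) (coord c p) by exists p.
have im' : \forall x \near coord c p, (coord c @` dom c) x.
  by apply: open_near => //; exact: codom_open.
have P' : \forall x \near coord c p, P (param c x).
  have := param_cts im; rewrite /prop_for /continuous_at (coordK cp).
  exact.
by apply: filterS2 im' P' => x [q cq <-]; rewrite coordK.
Qed.

Lemma near_dom c p : dom c p -> \forall q \near p, dom c q.
Proof. by move=> cp; apply: open_near => //; exact: dom_open. Qed.

Lemma near_coord c p (P : 'rV[R]_n -> Prop) : dom c p ->
  (\forall x \near coord c p, P x) -> \forall q \near p, P (coord c q).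
Proof. by move=> cp; exact: coord_cts. Qed.

Lemma open_chart_image c U : open U -> open (coord c @` (dom c `&` U)).
Proof.
move=> oU; rewrite openE => _ [p [cp Up] <-]; rewrite /interior/=.
have := near_chart cp (open_near oU Up).
by apply: filterS => x [dx xE Ux]; exists (param c x).
Qed.

Lemma smooth_in_chartsP (W : normedModType R) U (s : chart R n M -> M -> W) :
  open U -> smooth_in_charts U s <->
  forall c p, atlas c -> dom c p -> U p -> smooth_at (s c \o param c) (coord c p).
Proof.
move=> oU; split=> H c.
  move=> p ac cp Up; have oc := open_chart_image (c := c) oU.
  have [H' _] := Csmooth_smooth_at (s c \o param c) oc.
  by apply: H' (H _ ac) _ _; exists p.
move=> ac; have oc := open_chart_image (c := c) oU.
have [_ H'] := Csmooth_smooth_at (s c \o param c) oc.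
by apply: H' => _ [p [cp Up] <-]; exact: H.
Qed.

Lemma transition_smooth c d p : atlas c -> atlas d -> dom c p -> dom d p ->
  smooth_at (coord d \o param c) (coord c p).
Proof.
move=> ac ad cp dp; have oI := open_chart_image (c := c) (@dom_open _ _ _ d).
have [H _] := Csmooth_smooth_at (coord d \o param c) oI.
by apply: H; [exact: atlas_compat|exists p].
Qed.

(** Change of components of tangent vectors from the chart c to the chart d. *)
Definition jac c d p : 'rV[R]_n -> 'rV[R]_n := 'd (coord d \o param c) (coord c p).

Lemma jac_comp c d e p v : atlas c -> atlas d -> atlas e ->
  dom c p -> dom d p -> dom e p -> jac d e p (jac c d p v) = jac c e p v.
Proof.
move=> ac ad ae cp dp ep.
have S1 := transition_smooth ac ad cp dp; have S2 := transition_smooth ad ae dp ep.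
rewrite /jac; apply/esym/(diff_chain v S1) => //; first by rewrite /= coordK.
by apply: filterS (near_chart cp (near_dom dp)) => x [cx xE dx]; rewrite /= coordK.
Qed.

Lemma jac_id c p v : dom c p -> jac c c p v = v.
Proof.
move=> cp; rewrite /jac.
have E : \forall x \near coord c p, id x = (coord c \o param c) x.
  by apply: filterS (near_chart cp (near_dom cp)) => x [_ xE _] /=.
have [did Eid] := is_diff_id (coord c p).
by have := near_eq_diff E did => /(congr1 (fun F => F v)) <-; rewrite Eid.
Qed.

Lemma to_chartE c p v : to_chart c p v = jac (chart_at p) c p v.
Proof. by []. Qed.

Lemma of_chartE c p v : of_chart c p v = jac c (chart_at p) p v.
Proof. by []. Qed.

Lemma to_chart_jac c d p v : atlas c -> atlas d -> dom c p -> dom d p ->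
  to_chart d p v = jac c d p (to_chart c p v).
Proof.
have a0 := @chart_at_atlas _ _ _ p; have c0 := @chart_at_dom _ _ _ p.
by move=> ac ad cp dp; rewrite !to_chartE (jac_comp v a0 ac ad c0 cp dp).
Qed.

Lemma of_chartK c p v : atlas c -> dom c p -> to_chart c p (of_chart c p v) = v.
Proof.
have a0 := @chart_at_atlas _ _ _ p; have c0 := @chart_at_dom _ _ _ p.
move=> ac cp; rewrite to_chartE of_chartE (jac_comp v ac a0 ac cp c0 cp).
exact: jac_id.
Qed.

Lemma to_chartK c p v : atlas c -> dom c p -> of_chart c p (to_chart c p v) = v.
Proof.
have a0 := @chart_at_atlas _ _ _ p; have c0 := @chart_at_dom _ _ _ p.
move=> ac cp; rewrite to_chartE of_chartE (jac_comp v a0 ac a0 c0 cp c0).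
exact: jac_id.
Qed.

Lemma to_chart_linear c p : linear (to_chart c p).
Proof. exact: linearP. Qed.

Lemma of_chart_linear c p : linear (of_chart c p).
Proof. exact: linearP. Qed.

Lemma to_chartB c p u v : to_chart c p (u - v) = to_chart c p u - to_chart c p v.
Proof. exact: linearB. Qed.

Lemma of_chartD c p u v : of_chart c p (u + v) = of_chart c p u + of_chart c p v.
Proof. exact: linearD. Qed.

Lemma of_chartZ c p a v : of_chart c p (a *: v) = a *: of_chart c p v.
Proof. exact: linearZ. Qed.

Lemma of_chartB c p u v : of_chart c p (u - v) = of_chart c p u - of_chart c p v.
Proof. exact: linearB. Qed.

Definition vrep c (X : vfield M) (x : 'rV[R]_n) : 'rV[R]_n :=
  to_chart c (param c x) (X (param c x)).

Lemma vrep_coord c X p : dom c p -> vrep c X (coord c p) = to_chart c p (X p).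
Proof. by move=> cp; rewrite /vrep coordK. Qed.

(** This form no longer mentions a neighbourhood, so it combines with other
    properties that hold near p. *)
Lemma fun_nearP p f : fun_near p f <->
  \forall q \near p, forall c, atlas c -> dom c q -> smooth_at (f \o param c) (coord c q).
Proof.
split=> [[U [oU Up] Uf]|/near_open[U [oU Up] H]].
  have [H _] := smooth_in_chartsP (fun=> f) oU.
  by apply: filterS (open_near oU Up) => q Uq c ac cq; exact: H.
by exists U => //; apply/smooth_in_chartsP => // c q ac cq /H; exact.
Qed.

Lemma vfield_nearP p X : vfield_near p X <->
  \forall q \near p, forall c, atlas c -> dom c q -> smooth_at (vrep c X) (coord c q).
Proof.
split=> [[U [oU Up] Uf]|/near_open[U [oU Up] H]].
  have [H _] := smooth_in_chartsP (fun c q => to_chart c q (X q)) oU.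
  by apply: filterS (open_near oU Up) => q Uq c ac cq; exact: H.
exists U => //; apply/(smooth_in_chartsP (fun c q => to_chart c q (X q)) oU).
by move=> c q ac cq /H; exact.
Qed.

Lemma vfield_near_near p X : vfield_near p X -> \forall q \near p, vfield_near q X.
Proof.
move=> [U [oU Up] Uf]; apply: filterS (open_near oU Up) => q Uq.
by exists U.
Qed.

Lemma fun_near_rep c p f : atlas c -> dom c p -> fun_near p f ->
  smooth_at (f \o param c) (coord c p).
Proof. by move=> ac cp /fun_nearP/nbhs_singleton; exact. Qed.

Lemma vfield_near_rep c p X : atlas c -> dom c p -> vfield_near p X ->
  smooth_at (vrep c X) (coord c p).
Proof. by move=> ac cp /vfield_nearP/nbhs_singleton; exact. Qed.

Lemma fun_near_chart c p f : atlas c -> dom c p ->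
  smooth_at (f \o param c) (coord c p) -> fun_near p f.
Proof.
move=> ac cp /smooth_at_near/(near_coord cp) fs; apply/fun_nearP.
apply: filterS2 fs (near_dom cp) => q fq cq c' ac' c'q.
have St := transition_smooth ac' ac c'q cq.
apply: (smooth_at_chain St _ fq) => //; first by rewrite /= coordK.
by apply: filterS (near_chart c'q (near_dom cq)) => x [_ _ cx] /=; rewrite coordK.
Qed.

(** Smoothness in one chart suffices: in another chart the components are
    multiplied by the differential of a smooth transition map. *)
Lemma vfield_near_chart c p X : atlas c -> dom c p ->
  smooth_at (vrep c X) (coord c p) -> vfield_near p X.
Proof.
move=> ac cp /smooth_at_near/(near_coord cp) fs; apply/vfield_nearP.
apply: filterS2 fs (near_dom cp) => q fq cq c' ac' c'q.
have St := transition_smooth ac' ac c'q cq.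
have St' := transition_smooth ac ac' cq c'q.
have Eq : (coord c \o param c') (coord c' q) = coord c q by rewrite /= coordK.
have : smooth_at (fun x => 'd (coord c' \o param c) ((coord c \o param c') x)
   (vrep c X ((coord c \o param c') x))) (coord c' q).
  apply: smooth_at_diff_field => //; rewrite ?Eq//.
  by apply: smooth_at_comp => //; rewrite Eq.
apply: near_eq_smooth_at.
apply: filterS (near_chart c'q (near_dom cq)) => x [c'x xE cx] /=.
by rewrite vrep_coord// -/(jac _ _ _ _) -to_chart_jac.
Qed.

Lemma dderiv_chart c p v f : atlas c -> dom c p -> smooth_at (f \o param c) (coord c p) ->
  dderiv p v f = 'd (f \o param c) (coord c p) (to_chart c p v).
Proof.
move=> ac cp fs; have a0 := @chart_at_atlas _ _ _ p; have c0 := @chart_at_dom _ _ _ p.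
have St := transition_smooth a0 ac c0 cp.
rewrite /dderiv /to_chart.
apply: (diff_chain v St) => //; first by rewrite /= coordK.
by apply: filterS (near_chart c0 (near_dom cp)) => x [_ _ cx] /=; rewrite coordK.
Qed.

Lemma vfield_nearD p X Y : vfield_near p X -> vfield_near p Y ->
  vfield_near p (fun q => X q + Y q).
Proof.
have a0 := @chart_at_atlas _ _ _ p; have c0 := @chart_at_dom _ _ _ p.
move=> /(vfield_near_rep a0 c0) Xs /(vfield_near_rep a0 c0) Ys.
apply: (vfield_near_chart a0 c0); apply: near_eq_smooth_at (smooth_atD Xs Ys).
by near=> x; rewrite /vrep -[RHS]/('d _ _ _) linearD.
Unshelve. all: by end_near. Qed.

Lemma vfield_nearZ p f X : fun_near p f -> vfield_near p X ->
  vfield_near p (fun q => f q *: X q).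
Proof.
have a0 := @chart_at_atlas _ _ _ p; have c0 := @chart_at_dom _ _ _ p.
move=> /(fun_near_rep a0 c0) fs /(vfield_near_rep a0 c0) Xs.
apply: (vfield_near_chart a0 c0); apply: near_eq_smooth_at (smooth_atZ fs Xs).
by near=> x; rewrite /vrep -[RHS]/('d _ _ _) linearZ.
Unshelve. all: by end_near. Qed.

Lemma fun_near_cst p (a : R) : fun_near p (fun=> a).
Proof.
by apply: (fun_near_chart (@chart_at_atlas _ _ _ p) (@chart_at_dom _ _ _ p));
  exact: smooth_at_cst.
Qed.

Lemma near_eq_fun_near p f g : (\forall q \near p, f q = g q) -> fun_near p f ->
  fun_near p g.
Proof.
have a0 := @chart_at_atlas _ _ _ p; have c0 := @chart_at_dom _ _ _ p.
move=> fg /(fun_near_rep a0 c0) fs; apply: (fun_near_chart a0 c0).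
by apply: near_eq_smooth_at fs; apply: filterS (near_chart c0 fg) => x [].
Qed.

Lemma near_eq_vfield_near p X Y : (\forall q \near p, X q = Y q) -> vfield_near p X ->
  vfield_near p Y.
Proof.
have a0 := @chart_at_atlas _ _ _ p; have c0 := @chart_at_dom _ _ _ p.
move=> fg /(vfield_near_rep a0 c0) fs; apply: (vfield_near_chart a0 c0).
apply: near_eq_smooth_at fs; apply: filterS (near_chart c0 fg) => x [_ _ E].
by rewrite /vrep E.
Qed.

(** The field with constant components u in the chart c; only its values on the
    domain of c matter. *)
Definition coord_field c (u : 'rV[R]_n) : vfield M := fun q => of_chart c q u.

Lemma vrep_coord_field c u p : atlas c -> dom c p ->
  \forall x \near coord c p, vrep c (coord_field c u) x = u.
Proof.
move=> ac cp; apply: filterS (near_chart cp (near_dom cp)) => x [cx _ _].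
by rewrite /vrep of_chartK.
Qed.

Lemma coord_field_near c u p : atlas c -> dom c p -> vfield_near p (coord_field c u).
Proof.
move=> ac cp; apply: (vfield_near_chart ac cp).
apply: near_eq_smooth_at (smooth_at_cst u _).
by apply: filterS (vrep_coord_field u ac cp).
Qed.

Lemma vector_field_through p v : exists2 X, vfield_near p X & X p = v.
Proof.
have a0 := @chart_at_atlas _ _ _ p; have c0 := @chart_at_dom _ _ _ p.
exists (coord_field (chart_at p) v); first exact: coord_field_near.
exact: jac_id.
Qed.

Lemma coord_fun_near c p j : atlas c -> dom c p -> fun_near p (fun q => coord c q 0 j).
Proof.
move=> ac cp; apply: (fun_near_chart ac cp).
exact: (smooth_at_coord 0 j (transition_smooth ac ac cp cp)).
Qed.

Lemma dderiv_coord c p v j : atlas c -> dom c p ->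
  dderiv p v (fun q => coord c q 0 j) = to_chart c p v 0 j.
Proof.
move=> ac cp; have St := transition_smooth ac ac cp cp.
have Sj := smooth_at_coord 0 j St.
rewrite (dderiv_chart _ ac cp)// -(deriveE _ (smooth_at_differentiable Sj)).
rewrite (deriv_coord _ _ _ (smooth_at_differentiable St)).
by rewrite (deriveE _ (smooth_at_differentiable St)) -/(jac _ _ _ _) jac_id.
Qed.

(** The derivatives of the coordinate functions along v are the components of v. *)
Lemma dderiv_inj p v : (forall f, fun_near p f -> dderiv p v f = 0) -> v = 0.
Proof.
have a0 := @chart_at_atlas _ _ _ p; have c0 := @chart_at_dom _ _ _ p.
move=> H; rewrite -(to_chartK v a0 c0).
have -> : to_chart (chart_at p) p v = 0.
  by apply/rowP => j; rewrite -dderiv_coord// H ?mxE//; exact: coord_fun_near.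
exact: linear0.
Qed.

Lemma near_eq_dderiv p v f g : (\forall q \near p, f q = g q) -> fun_near p f ->
  dderiv p v f = dderiv p v g.
Proof.
have a0 := @chart_at_atlas _ _ _ p; have c0 := @chart_at_dom _ _ _ p.
move=> fg /(fun_near_rep a0 c0)/smooth_at_differentiable fs.
apply/esym/near_eq_diff_val => //.
by apply: filterS (near_chart c0 fg) => x [].
Qed.

Lemma dderivB p u v f : dderiv p (u - v) f = dderiv p u f - dderiv p v f.
Proof. exact: linearB. Qed.

Lemma dderiv_dderiv c p v f Y : atlas c -> dom c p -> fun_near p f -> vfield_near p Y ->
  dderiv p v (fun q => dderiv q (Y q) f) =
  'D_(to_chart c p v) (fun z => 'd (f \o param c) z (vrep c Y z)) (coord c p).
Proof.
move=> ac cp fp Yp; have fs := fun_near_rep ac cp fp.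
have Ys := vfield_near_rep ac cp Yp.
have S : smooth_at (fun z => 'd (f \o param c) z (vrep c Y z)) (coord c p).
  by apply: (smooth_at_diff_field (y := id)) => //; exact: smooth_at_id.
have E : \forall x \near coord c p, 'd (f \o param c) x (vrep c Y x) =
    ((fun q => dderiv q (Y q) f) \o param c) x.
  apply: filterS2 (near_chart cp (near_dom cp)) (smooth_at_near fs) => x [cx xE _] fx.
  have := @dderiv_chart c (param c x) (Y (param c x)) f ac cx.
  by rewrite xE => /(_ fx) /= ->.
rewrite (dderiv_chart v ac cp (near_eq_smooth_at E S)).
apply: etrans (near_eq_diff_val _ E (smooth_at_differentiable S)) _.
exact/esym/deriveE/smooth_at_differentiable.
Qed.

End Charts.

(** * Christoffel symbols of an affine connection *)

Section Connection.
Variables (R : realType) (n : nat) (M : manifold R n).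
Variable nabla : vfield M -> vfield M -> vfield M.
Hypothesis aff : affine_connection nabla.
Implicit Types (d : chart R n M) (p q : M) (X Y : vfield M).

Lemma dderiv_cst p v (a : R) : dderiv (M := M) p v (fun=> a) = 0.
Proof.
rewrite /dderiv -deriveE; last exact: differentiable_cst.
exact: derive_cst.
Qed.

Lemma nabla_scaler p (a : R) X Y : vfield_near p X -> vfield_near p Y ->
  nabla X (fun q => a *: Y q) p = a *: nabla X Y p.
Proof.
move=> Xp Yp; rewrite (nabla_leibniz aff (fun_near_cst p a) Xp Yp).
by rewrite dderiv_cst scale0r add0r.
Qed.

Lemma nabla_linear_r p (a : R) X Y Y' : vfield_near p X -> vfield_near p Y ->
  vfield_near p Y' ->
  nabla X (fun q => a *: Y q + Y' q) p = a *: nabla X Y p + nabla X Y' p.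
Proof.
move=> Xp Yp Y'p; have aY := vfield_nearZ (fun_near_cst p a) Yp.
by rewrite (nabla_addr aff Xp aY Y'p) nabla_scaler.
Qed.

(** The values of Y far from p are arbitrary, but the Leibniz rule with a function
    that vanishes near p discards them. *)
Lemma nabla_local p X Y Y' : vfield_near p X -> vfield_near p Y ->
  (\forall q \near p, Y q = Y' q) -> nabla X Y p = nabla X Y' p.
Proof.
move=> Xp Yp YY'; have Y'p := near_eq_vfield_near YY' Yp.
(* Y = f (Y - Y') + Y' everywhere, and f is 0 near p; it plays the part of a
   cutoff function, for which smoothness near p is enough *)
pose f q : R := if Y q == Y' q then 0 else 1.
have f0 : \forall q \near p, 0 = f q.
  by apply: filterS YY' => q E; rewrite /f E eqxx.
have fp := near_eq_fun_near f0 (fun_near_cst p 0).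
have Dp : vfield_near p (fun q => Y q + (- 1 : R) *: Y' q).
  exact: vfield_nearD Yp (vfield_nearZ (fun_near_cst p (-1)) Y'p).
have -> : Y = fun q => f q *: (Y q + (- 1 : R) *: Y' q) + Y' q.
  apply/funext => q; rewrite /f; case: eqP => [->|_].
    by rewrite scale0r add0r.
  by rewrite scale1r scaleN1r subrK.
rewrite (nabla_addr aff Xp (vfield_nearZ fp Dp) Y'p) (nabla_leibniz aff fp Xp Dp).
by rewrite -(nbhs_singleton f0) (nbhs_singleton YY') scaleN1r subrr scaler0 scale0r !add0r.
Qed.

Lemma nabla_sum p (I : Type) (r : seq I) (f : I -> M -> R) X (Z : I -> vfield M) :
  vfield_near p X -> (forall i, fun_near p (f i)) -> (forall i, vfield_near p (Z i)) ->
  vfield_near p (fun q => \sum_(i <- r) f i q *: Z i q) /\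
  nabla X (fun q => \sum_(i <- r) f i q *: Z i q) p =
  \sum_(i <- r) (dderiv p (X p) (f i) *: Z i p + f i p *: nabla X (Z i) p).
Proof.
move=> Xp fp Zp; elim: r => [|i r [IH1 IH2]].
  have E : (fun q => 0 *: X q) = (fun q : M => \sum_(i <- [::]) f i q *: Z i q).
    by apply/funext => q; rewrite big_nil scale0r.
  rewrite -E big_nil nabla_scaler// scale0r; split => //.
  exact: vfield_nearZ (fun_near_cst p 0) Xp.
have fZ := vfield_nearZ (fp i) (Zp i).
have -> : (fun q : M => \sum_(j <- i :: r) f j q *: Z j q) =
    fun q => f i q *: Z i q + \sum_(j <- r) f j q *: Z j q.
  by apply/funext => q; rewrite big_cons.
rewrite big_cons (nabla_addr aff Xp fZ IH1) IH2 (nabla_leibniz aff (fp i) Xp (Zp i)).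
by split => //; exact: vfield_nearD.
Qed.

(** The Christoffel symbols as a bilinear map: the components of the covariant
    derivative along u of the coordinate field v. *)
Definition christoffel d (y u v : 'rV[R]_n) : 'rV[R]_n :=
  vrep d (nabla (coord_field d u) (coord_field d v)) y.

Lemma christoffel_coord d p u v : dom d p ->
  christoffel d (coord d p) u v = to_chart d p (nabla (coord_field d u) (coord_field d v) p).
Proof. exact: vrep_coord. Qed.

Lemma christoffel_smooth d p u v : atlas d -> dom d p ->
  smooth_at (fun y => christoffel d y u v) (coord d p).
Proof.
move=> ad dp; apply: (vfield_near_rep ad dp).
by apply: (nabla_smooth aff); exact: coord_field_near.
Qed.

Lemma christoffel_linear_l d p v : atlas d -> dom d p ->
  linear (fun u => christoffel d (coord d p) u v).
Proof.
move=> ad dp a u w; rewrite !christoffel_coord//.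
have -> : coord_field d (a *: u + w) = fun q => a *: coord_field d u q + coord_field d w q.
  by apply/funext => q; exact: of_chart_linear.
rewrite (nabla_linl aff (fun_near_cst p a)); first exact: to_chart_linear.
all: exact: coord_field_near.
Qed.

Lemma christoffel_linear_r d p u : atlas d -> dom d p ->
  linear (christoffel d (coord d p) u).
Proof.
move=> ad dp a v w; rewrite !christoffel_coord//.
have -> : coord_field d (a *: v + w) = fun q => a *: coord_field d v q + coord_field d w q.
  by apply/funext => q; exact: of_chart_linear.
rewrite nabla_linear_r; first exact: to_chart_linear.
all: exact: coord_field_near.
Qed.

Lemma near_linear_christoffel_l d p : atlas d -> dom d p ->
  \forall y \near coord d p, forall v, linear (fun u => christoffel d y u v).
Proof.
move=> ad dp; apply: filterS (near_chart dp (near_dom dp)) => y [dy <- _] v.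
exact: christoffel_linear_l.
Qed.

Lemma near_linear_christoffel_r d p : atlas d -> dom d p ->
  \forall y \near coord d p, forall u, linear (christoffel d y u).
Proof.
move=> ad dp; apply: filterS (near_chart dp (near_dom dp)) => y [dy <- _] u.
exact: christoffel_linear_r.
Qed.

(** The field Y is near p the combination of the coordinate fields e_j by its components. *)
Lemma to_chart_nabla d p w Y : atlas d -> dom d p -> vfield_near p Y ->
  to_chart d p (nabla (coord_field d w) Y p) =
  'D_w (vrep d Y) (coord d p) +
  christoffel d (coord d p) w (vrep d Y (coord d p)).
Proof.
move=> ad dp Yp; have Ys := vfield_near_rep ad dp Yp.
pose f j q := vrep d Y (coord d q) 0 j.
have fs j : smooth_at (f j \o param d) (coord d p).
  apply: near_eq_smooth_at (smooth_at_coord 0 j Ys).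
  by apply: filterS (near_chart dp (near_dom dp)) => y [dy yE _]; rewrite /f /= yE.
have fp j : fun_near p (f j) by exact: fun_near_chart (fs j).
have Xp := coord_field_near w ad dp.
have Zp (j : 'I_n) : vfield_near p (coord_field d 'e_j) by exact: coord_field_near.
have YE : \forall q \near p, Y q = \sum_j f j q *: coord_field d 'e_j q.
  apply: filterS (near_dom dp) => q dq.
  rewrite -[LHS](to_chartK _ ad dq) -(vrep_coord _ dq).
  exact: (linear_rowE _ (@of_chart_linear _ _ _ d q)).
rewrite (nabla_local Xp Yp YE).
have [_ ->] := nabla_sum (index_enum _) Xp fp Zp.
rewrite big_split/= -[LHS]/('d _ _ _) linearD; congr (_ + _).
  rewrite linear_sum [RHS]row_sum_coord; apply: eq_bigr => j _.
  transitivity (dderiv p (coord_field d w p) (f j) *: to_chart d p (coord_field d 'e_j p)).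
    exact: linearZ.
  rewrite /coord_field of_chartK//; congr (_ *: _); rewrite -deriv_coord; last exact: smooth_at_differentiable.
  rewrite (dderiv_chart _ ad dp (fs j)) of_chartK//.
  rewrite -deriveE; last exact: smooth_at_differentiable.
  apply: near_eq_derive.
  by apply: filterS (near_chart dp (near_dom dp)) => y [dy yE _]; rewrite /f /= yE.
rewrite [RHS](linear_rowE _ (christoffel_linear_r w ad dp)) linear_sum.
by apply: eq_bigr => j _; rewrite linearZ christoffel_coord.
Qed.

End Connection.

(** * Components of tensor fields in a chart *)

Section TensorsInCharts.
Variables (R : realType) (n : nat) (M : manifold R n).
Implicit Types (d : chart R n M) (p q : M).

Definition rep1 d (eta : oneform M) (y u : 'rV[R]_n) : R :=
  eta (param d y) (of_chart d (param d y) u).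

Definition rep11 d (phi : tensor11 M) (y u : 'rV[R]_n) : 'rV[R]_n :=
  to_chart d (param d y) (phi (param d y) (of_chart d (param d y) u)).

Definition rep02 d (g : tensor02 M) (y u v : 'rV[R]_n) : R :=
  g (param d y) (of_chart d (param d y) u) (of_chart d (param d y) v).

Lemma rep1_coord d eta p u : dom d p -> rep1 d eta (coord d p) u = eta p (of_chart d p u).
Proof. by move=> dp; rewrite /rep1 coordK. Qed.

Lemma rep11_coord d phi p u : dom d p ->
  rep11 d phi (coord d p) u = to_chart d p (phi p (of_chart d p u)).
Proof. by move=> dp; rewrite /rep11 coordK. Qed.

Lemma rep02_coord d g p u v : dom d p ->
  rep02 d g (coord d p) u v = g p (of_chart d p u) (of_chart d p v).
Proof. by move=> dp; rewrite /rep02 coordK. Qed.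

Lemma smooth_oneformP eta : smooth_oneform eta <->
  (forall p, scalar (eta p)) /\
  forall d p u, atlas d -> dom d p -> smooth_at (fun y => rep1 d eta y u) (coord d p).
Proof.
split=> -[leta seta]; split=> //.
  move=> d p u ad dp.
  by have [H _] := smooth_in_chartsP (fun c p => eta p (of_chart c p u)) openT; exact: H.
move=> u; apply/(smooth_in_chartsP (fun c p => eta p (of_chart c p u)) openT).
by move=> c p ac cp _; exact: seta.
Qed.

Lemma smooth_tensor11P phi : smooth_tensor11 phi <->
  (forall p, linear (phi p)) /\
  forall d p u, atlas d -> dom d p -> smooth_at (fun y => rep11 d phi y u) (coord d p).
Proof.
split=> -[leta seta]; split=> //.
  move=> d p u ad dp.
  have [H _] := smooth_in_chartsP (fun c p => to_chart c p (phi p (of_chart c p u))) openT.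
  exact: H.
move=> u; apply/(smooth_in_chartsP (fun c p => to_chart c p (phi p (of_chart c p u))) openT).
by move=> c p ac cp _; exact: seta.
Qed.

Lemma smooth_tensor02P g : smooth_tensor02 g <->
  (forall p v, scalar (g p v) /\ scalar (fun w => g p w v)) /\
  forall d p u v, atlas d -> dom d p -> smooth_at (fun y => rep02 d g y u v) (coord d p).
Proof.
split=> -[leta seta]; split=> //.
  move=> d p u w ad dp.
  have [H _] := smooth_in_chartsP (fun c p => g p (of_chart c p u) (of_chart c p w)) openT.
  exact: H.
move=> u w; apply/(smooth_in_chartsP (fun c p => g p (of_chart c p u) (of_chart c p w)) openT).
by move=> c p ac cp _; exact: seta.
Qed.

Lemma rep1_linear d eta y : (forall p, scalar (eta p)) -> scalar (rep1 d eta y).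
Proof. by move=> l a u v; rewrite /rep1 of_chart_linear l. Qed.

Lemma rep11_linear d phi y : (forall p, linear (phi p)) -> linear (rep11 d phi y).
Proof. by move=> l a u v; rewrite /rep11 of_chart_linear l to_chart_linear. Qed.

Lemma rep02_linear_r d g y u : (forall p v, scalar (g p v)) -> scalar (rep02 d g y u).
Proof. by move=> l a v w; rewrite /rep02 of_chart_linear l. Qed.

Lemma rep02_linear_l d g y v : (forall p v, scalar (fun w => g p w v)) ->
  scalar (fun u => rep02 d g y u v).
Proof. by move=> l a u w; rewrite /rep02 of_chart_linear l. Qed.

End TensorsInCharts.

Section ConnectionTensors.
Variables (R : realType) (n : nat) (M : manifold R n).
Variable nabla : vfield M -> vfield M -> vfield M.
Hypothesis aff : affine_connection nabla.
Implicit Types (d : chart R n M) (p q : M) (X Y : vfield M).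

(** Coordinate fields commute, as can be tested on the coordinate functions. *)
Lemma christoffel_sym d p u v : torsion_free nabla -> atlas d -> dom d p ->
  christoffel nabla d (coord d p) u v = christoffel nabla d (coord d p) v u.
Proof.
move=> tf ad dp; rewrite !christoffel_coord//; apply/eqP; rewrite -subr_eq0.
have -> : to_chart d p (nabla (coord_field d u) (coord_field d v) p) -
    to_chart d p (nabla (coord_field d v) (coord_field d u) p) =
    to_chart d p (nabla (coord_field d u) (coord_field d v) p -
      nabla (coord_field d v) (coord_field d u) p) by exact/esym/linearB.
apply/eqP/rowP => j; rewrite -dderiv_coord// mxE.
have up := coord_field_near u ad dp; have vp := coord_field_near v ad dp.
rewrite (tf _ _ _ _ up vp (coord_fun_near j ad dp)).
have Z (w w' : 'rV[R]_n) : dderiv p (coord_field d w p)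
    (fun q => dderiv q (coord_field d w' q) (fun q => coord d q 0 j)) = 0.
  have E : \forall q \near p, w' 0 j = dderiv q (coord_field d w' q) (fun q => coord d q 0 j).
    by apply: filterS (near_dom dp) => q dq; rewrite dderiv_coord// of_chartK.
  by rewrite -(near_eq_dderiv _ E (fun_near_cst p _)) dderiv_cst.
by rewrite !Z subrr.
Qed.

Lemma christoffel_metric d g p u v w : smooth_tensor02 g -> metric_compatible g nabla ->
  atlas d -> dom d p ->
  'd (fun y => rep02 d g y u v) (coord d p) w =
  rep02 d g (coord d p) (christoffel nabla d (coord d p) w u) v +
  rep02 d g (coord d p) u (christoffel nabla d (coord d p) w v).
Proof.
move=> /smooth_tensor02P[lg sg] mc ad dp.
have := mc p _ _ _ (coord_field_near w ad dp) (coord_field_near u ad dp) (coord_field_near v ad dp).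
rewrite (dderiv_chart _ ad dp (sg _ _ u v ad dp)) /coord_field of_chartK// => ->.
by rewrite !rep02_coord// !christoffel_coord// !to_chartK.
Qed.

Lemma to_chart_nabla_tensor11 d phi p w v : smooth_tensor11 phi -> atlas d -> dom d p ->
  to_chart d p (nabla_tensor11 nabla phi (coord_field d w) (coord_field d v) p) =
  'd (fun y => rep11 d phi y v) (coord d p) w +
  christoffel nabla d (coord d p) w (rep11 d phi (coord d p) v) -
  rep11 d phi (coord d p) (christoffel nabla d (coord d p) w v).
Proof.
move=> /smooth_tensor11P[lphi sphi] ad dp.
have Yp : vfield_near p (fun q => phi q (coord_field d v q)).
  exact: (vfield_near_chart ad dp (sphi _ _ v ad dp)).
rewrite /nabla_tensor11 to_chartB.
rewrite (to_chart_nabla aff w ad dp Yp) vrep_coord//.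
rewrite (rep11_coord phi v dp).
rewrite (rep11_coord phi _ dp).
rewrite (christoffel_coord nabla w v dp).
rewrite to_chartK//.
by rewrite (deriveE _ (smooth_at_differentiable (sphi _ _ v ad dp))).
Qed.

End ConnectionTensors.

(** * Smoothness of a field from its inner products *)

Section DualFields.
Variables (R : realType) (n : nat) (M : manifold R n) (g : tensor02 M).
Hypothesis sg : smooth_tensor02 g.
Hypothesis ndg : forall p, nondeg (g p).

Lemma tensor02_bilin p : bilin (g p).
Proof. by move=> v; exact: (proj1 sg). Qed.

(** The components of X solve the linear system whose matrix is the Gram matrix of
    the coordinate fields. *)
Lemma smooth_dual c p (X : vfield M) : atlas c -> dom c p ->
  (forall j, smooth_at
    (fun x => g (param c x) (X (param c x)) (of_chart c (param c x) 'e_j)) (coord c p)) ->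
  smooth_at (vrep c X) (coord c p).
Proof.
move=> ac cp sX; have [_ sr] := (smooth_tensor02P g).1 sg.
pose s x : 'rV[R]_n :=
  \row_j g (param c x) (X (param c x)) (of_chart c (param c x) 'e_j).
have bl x : bilin (rep02 c g x).
  move=> v; split; last by apply: rep02_linear_l => q w; exact: (tensor02_bilin q w).2.
  by apply: rep02_linear_r => q w; exact: (tensor02_bilin q w).1.
have nd q : dom c q -> nondeg (rep02 c g (coord c q)).
  move=> cq v v0; rewrite -(of_chartK v ac cq).
  suff -> : of_chart c q v = 0 by exact: linear0.
  by apply: (ndg (p := q)) => w; rewrite -(to_chartK w ac cq) -rep02_coord// v0.
have E : \forall x \near coord c p, s x *m invmx (gram (rep02 c g x)) = vrep c X x.
  apply: filterS (near_chart cp (near_dom cp)) => x [cx xE _].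
  rewrite -[RHS](@mulmxK _ _ _ (gram (rep02 c g x))); last first.
    by apply: nondeg_gram; [exact: bl|rewrite -xE; exact: nd].
  congr (_ *m _); apply/rowP => j; rewrite gram_mulmx; last exact: bl.
  by rewrite mxE /rep02 /vrep to_chartK.
apply: near_eq_smooth_at E _; apply: smooth_at_row => j.
have sG k l : smooth_at (fun x => gram (rep02 c g x) k l) (coord c p).
  by apply: near_eq_smooth_at (sr c p 'e_k 'e_l ac cp); near=> x; rewrite mxE.
have : forall k, true ->
    smooth_at (fun x => s x 0 k * invmx (gram (rep02 c g x)) k j) (coord c p).
  move=> k _; apply: smooth_atM.
    by apply: near_eq_smooth_at (sX k); near=> x; rewrite mxE.
  by apply: smooth_at_invmx => //; apply: nondeg_gram; [exact: bl|exact: nd].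
move=> /(smooth_at_sum (index_enum _)).
by apply: near_eq_smooth_at; near=> x; rewrite mxE.
Unshelve. all: by end_near. Qed.

End DualFields.

(** * Smooth maps and pullbacks *)

Section Maps.
Variables (R : realType) (m n : nat) (M : manifold R m) (N : manifold R n).
Variable i : M -> N.
Hypothesis si : smooth_map i.
Implicit Types (c : chart R m M) (d : chart R n N) (p q : M).

Lemma near_map p (P : N -> Prop) : (\forall q \near i p, P q) -> \forall q \near p, P (i q).
Proof. by case: si => ci _; exact: ci. Qed.

Lemma near_chart_map c d p : dom c p -> dom d (i p) -> \forall x \near coord c p,
  [/\ dom c (param c x), coord c (param c x) = x & dom d (i (param c x))].
Proof.
by move=> cp dp; exact: (near_chart (P := fun q => dom d (i q)) cp (near_map (near_dom dp))).
Qed.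

Definition local_map c d : 'rV[R]_m -> 'rV[R]_n := coord d \o i \o param c.

Lemma local_map_coord c d p : dom c p -> local_map c d (coord c p) = coord d (i p).
Proof. by move=> cp; rewrite /local_map /= coordK. Qed.

Lemma local_map_smooth c d p : atlas c -> atlas d -> dom c p -> dom d (i p) ->
  smooth_at (local_map c d) (coord c p).
Proof.
move=> ac ad cp dp; case: si => ci /(_ c d ac ad) H.
have oU : open (i @^-1` dom d) by move/continuousP : ci; apply; exact: dom_open.
have [H' _] := Csmooth_smooth_at (local_map c d) (open_chart_image (c := c) oU).
by apply: H' => //; exists p.
Qed.

Lemma to_chart_push c d p v : atlas c -> atlas d -> dom c p -> dom d (i p) ->
  to_chart d (i p) (push i p v) = 'd (local_map c d) (coord c p) (to_chart c p v).
Proof.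
move=> ac ad cp dp.
have a0 := @chart_at_atlas _ _ _ p; have c0 := @chart_at_dom _ _ _ p.
have b0 := @chart_at_atlas _ _ _ (i p); have d0 := @chart_at_dom _ _ _ (i p).
have St := transition_smooth a0 ac c0 cp.
have Sd := transition_smooth b0 ad d0 dp.
have S0 := local_map_smooth a0 b0 c0 d0; have S1 := local_map_smooth ac ad cp dp.
transitivity ('d (local_map (chart_at p) d) (coord (chart_at p) p) v).
  apply/esym/(diff_chain v S0) => //; first by rewrite local_map_coord.
  apply: filterS (near_chart_map c0 d0) => x [_ _ dx].
  by rewrite /local_map /= coordK.
apply: (diff_chain v St) => //; first by rewrite /= coordK.
by apply: filterS (near_chart c0 (near_dom cp)) => x [_ _ cx]; rewrite /local_map /= coordK.
Qed.

Lemma push_of_chart c d p u : atlas c -> atlas d -> dom c p -> dom d (i p) ->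
  push i p (of_chart c p u) = of_chart d (i p) ('d (local_map c d) (coord c p) u).
Proof.
move=> ac ad cp dp.
by rewrite -[LHS](to_chartK _ ad dp) (to_chart_push _ ac ad cp dp) of_chartK.
Qed.

Lemma push_linear p : linear (push i p).
Proof. exact: linearP. Qed.

Lemma pullback1_coord c d p eta u : atlas c -> atlas d -> dom c p -> dom d (i p) ->
  rep1 c (pullback1 i eta) (coord c p) u =
  rep1 d eta (local_map c d (coord c p)) ('d (local_map c d) (coord c p) u).
Proof.
move=> ac ad cp dp; rewrite local_map_coord// !rep1_coord// /pullback1.
by rewrite (push_of_chart _ ac ad cp dp).
Qed.

Lemma pullback2_coord c d p g u v : atlas c -> atlas d -> dom c p -> dom d (i p) ->
  rep02 c (pullback2 i g) (coord c p) u v =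
  rep02 d g (local_map c d (coord c p)) ('d (local_map c d) (coord c p) u)
    ('d (local_map c d) (coord c p) v).
Proof.
move=> ac ad cp dp; rewrite local_map_coord// !rep02_coord// /pullback2.
by rewrite !(push_of_chart _ ac ad cp dp).
Qed.

Lemma smooth_pullback1 eta : smooth_oneform eta -> smooth_oneform (pullback1 i eta).
Proof.
move=> /smooth_oneformP[le se]; apply/smooth_oneformP; split.
  by move=> p a u v; rewrite /pullback1 push_linear le.
move=> c p u ac cp; have b0 := @chart_at_atlas _ _ _ (i p).
have d0 := @chart_at_dom _ _ _ (i p); set d := chart_at (i p) in b0 d0.
have S1 := local_map_smooth ac b0 cp d0.
have : smooth_at (fun x => rep1 d eta (local_map c d x) ('d (local_map c d) x u)) (coord c p).
  apply: (smooth_at_family (A := fun y w => rep1 d eta y w : R^o)) => //.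
  - by near=> z; exact: rep1_linear.
  - by move=> w; rewrite local_map_coord//; exact: se.
  - exact: smooth_at_diff.
apply: near_eq_smooth_at.
apply: filterS (near_chart_map cp d0) => x [cx xE dx].
by have := pullback1_coord eta u ac b0 cx dx; rewrite xE => ->.
Unshelve. all: by end_near. Qed.

Lemma smooth_pullback2 g : smooth_tensor02 g -> smooth_tensor02 (pullback2 i g).
Proof.
move=> /smooth_tensor02P[le se]; apply/smooth_tensor02P; split.
  move=> p v; split=> a u w; rewrite /pullback2 push_linear.
    by rewrite (le _ _).1.
  by rewrite (le _ _).2.
move=> c p u v ac cp; have b0 := @chart_at_atlas _ _ _ (i p).
have d0 := @chart_at_dom _ _ _ (i p); set d := chart_at (i p) in b0 d0.
have S1 := local_map_smooth ac b0 cp d0.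
have : smooth_at (fun x => rep02 d g (local_map c d x) ('d (local_map c d) x u)
    ('d (local_map c d) x v)) (coord c p).
  apply: (smooth_at_family2 (A := fun y w w' => rep02 d g y w w' : R^o)) => //.
  - by near=> z => w; apply: rep02_linear_l => q z'; exact: (le _ _).2.
  - by near=> z => w; apply: rep02_linear_r => q z'; exact: (le _ _).1.
  - by move=> w w'; rewrite local_map_coord//; exact: se.
  - exact: smooth_at_diff.
  - exact: smooth_at_diff.
apply: near_eq_smooth_at.
apply: filterS (near_chart_map cp d0) => x [cx xE dx].
by have := pullback2_coord g u v ac b0 cx dx; rewrite xE => ->.
Unshelve. all: by end_near. Qed.

End Maps.

(** * Uniqueness of the Levi-Civita connection at a point *)

Section LeviCivitaUnique.
Variables (R : realType) (n : nat) (M : manifold R n) (g : tensor02 M) (p : M).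
Hypothesis bg : bilin (g p).
Hypothesis gsym : forall v w, g p v w = g p w v.
Hypothesis ndg : nondeg (g p).

Definition torsion_free_at (T : vfield M -> vfield M -> 'rV[R]_n) : Prop :=
  forall X Y f, vfield_near p X -> vfield_near p Y -> fun_near p f ->
    dderiv p (T X Y - T Y X) f =
    dderiv p (X p) (fun q => dderiv q (Y q) f)
    - dderiv p (Y p) (fun q => dderiv q (X q) f).

Definition metric_compatible_at (T : vfield M -> vfield M -> 'rV[R]_n) : Prop :=
  forall X Y Z, vfield_near p X -> vfield_near p Y -> vfield_near p Z ->
    dderiv p (X p) (fun q => g q (Y q) (Z q)) =
    g p (T X Y) (Z p) + g p (Y p) (T X Z).

(** The difference S of the two connections gives the form
    b(X, Y, Z) = g(S(X, Y), Z), symmetric in X, Y by the torsion condition and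
    antisymmetric in Y, Z by metric compatibility; such a form vanishes. *)
Lemma levi_civita_unique T1 T2 :
  torsion_free_at T1 -> metric_compatible_at T1 ->
  torsion_free_at T2 -> metric_compatible_at T2 ->
  forall X Y, vfield_near p X -> vfield_near p Y -> T1 X Y = T2 X Y.
Proof.
move=> t1 m1 t2 m2 X Y Xp Yp.
pose b U V W := g p (T1 U V - T2 U V) (W p).
have bE U V W : b U V W = g p (T1 U V) (W p) - g p (T2 U V) (W p).
  by rewrite /b -scaleN1r (bilinDl _ _ _ bg) (bilinZl _ _ _ bg) mulN1r.
have bsym U V W : vfield_near p U -> vfield_near p V -> b U V W = b V U W.
  move=> Up Vp; rewrite /b; congr (g p _ _).
  have : (T1 U V - T1 V U) - (T2 U V - T2 V U) = 0.
    apply: (dderiv_inj (p := p)) => f fp.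
    by rewrite dderivB (t1 _ _ _ Up Vp fp) (t2 _ _ _ Up Vp fp) subrr.
  move=> /eqP; rewrite subr_eq0 => /eqP E.
  rewrite -[T1 U V](subrK (T1 V U)) E addrAC [_ - T2 V U - _]addrAC subrr add0r.
  by rewrite addrC.
have banti U V W : vfield_near p U -> vfield_near p V -> vfield_near p W ->
    b U V W = - b U W V.
  move=> Up Vp Wp; have := m1 _ _ _ Up Vp Wp; rewrite (m2 _ _ _ Up Vp Wp).
  rewrite !bE (gsym (V p)) (gsym (V p)); lra.
apply/eqP; rewrite -subr_eq0; apply/eqP/ndg => w.
have [Z Zp <-] := vector_field_through p w; rewrite -/(b X Y Z).
suff : b X Y Z = - b X Y Z by lra.
(* b(X,Y,Z) = b(Y,X,Z) = -b(Y,Z,X) = -b(Z,Y,X) = b(Z,X,Y) = b(X,Z,Y) = -b(X,Y,Z) *)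
by rewrite {1}bsym// banti// [in LHS]bsym// banti// opprK [in LHS]bsym// banti//.
Qed.

End LeviCivitaUnique.

(** * The Gauss connection of an immersion *)

Section GaussConnection.
Variables (R : realType) (m n : nat) (M : manifold R m) (N : manifold R n).
Variables (i : M -> N) (g : tensor02 N) (nabla : vfield N -> vfield N -> vfield N).
Hypothesis si : smooth_map i.
Hypothesis sg : smooth_tensor02 g.
Hypothesis gsym : forall p v w, g p v w = g p w v.
Hypothesis aff : affine_connection nabla.
Hypothesis tf : torsion_free nabla.
Hypothesis mc : metric_compatible g nabla.
Hypothesis ndg : forall p, nondeg (pullback2 i g p).
Implicit Types (c : chart R m M) (d : chart R n N) (p q : M) (X Y Z : vfield M).

Let gs := pullback2 i g.

Lemma smooth_induced_metric : smooth_tensor02 gs.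
Proof. exact: smooth_pullback2. Qed.

Lemma induced_metric_bilin p : bilin (gs p).
Proof. exact: tensor02_bilin smooth_induced_metric p. Qed.

Lemma g_bilin r : bilin (g r).
Proof. exact: tensor02_bilin sg r. Qed.

(** The orthogonal projection T_(i p) N -> T_p M, defined by duality with respect to
    the induced metric. *)
Definition tanproj p (W : 'rV[R]_n) : 'rV[R]_m :=
  xget 0 [set w | forall z, gs p w z = g (i p) W (push i p z)].

Lemma tanprojP p W z : gs p (tanproj p W) z = g (i p) W (push i p z).
Proof.
have sc : scalar (fun z => g (i p) W (push i p z)).
  by move=> a u v; rewrite push_linear; exact: (g_bilin (i p) W).1.
have [w Hw] := nondeg_represent (induced_metric_bilin p) (@ndg p) sc.
by rewrite /tanproj; case: xgetP => [w' _ ->//|/(_ w)]; case.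
Qed.

Lemma tanproj_unique p W w : (forall z, gs p w z = g (i p) W (push i p z)) ->
  tanproj p W = w.
Proof.
move=> H; apply/eqP; rewrite -subr_eq0; apply/eqP/(ndg (p := p)) => z.
rewrite -/(gs _ _ _) (bilinDl _ _ _ (induced_metric_bilin p)) tanprojP -scaleN1r.
by rewrite (bilinZl _ _ _ (induced_metric_bilin p)) H mulN1r subrr.
Qed.

Lemma tanproj_linear p : linear (tanproj p).
Proof.
move=> a W W'; apply: tanproj_unique => z.
rewrite (bilinDl _ _ _ (induced_metric_bilin p)) (bilinZl _ _ _ (induced_metric_bilin p)) !tanprojP.
by rewrite (bilinDl _ _ _ (g_bilin (i p))) (bilinZl _ _ _ (g_bilin (i p))).
Qed.

Lemma tanprojD p W W' : tanproj p (W + W') = tanproj p W + tanproj p W'.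
Proof. by have := tanproj_linear p 1 W W'; rewrite !scale1r. Qed.

Lemma tanprojZ p a W : tanproj p (a *: W) = a *: tanproj p W.
Proof.
have t0 : tanproj p 0 = 0.
  apply: tanproj_unique => z.
  by rewrite (bilin0l _ (induced_metric_bilin p)) (bilin0l _ (g_bilin _)).
by have := tanproj_linear p a W 0; rewrite !addr0 t0 addr0.
Qed.

Lemma tanprojB p W W' : tanproj p (W - W') = tanproj p W - tanproj p W'.
Proof. by rewrite tanprojD -[- W']scaleN1r tanprojZ scaleN1r. Qed.

Lemma tanproj_push p v : tanproj p (push i p v) = v.
Proof. by apply: tanproj_unique. Qed.

(** The components in the chart d of the field i_* X along the map i. *)
Definition pushed c d X (x : 'rV[R]_m) : 'rV[R]_n :=
  'd (local_map i c d) x (vrep c X x).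

(** The ambient covariant derivative of i_* Y along X, in the charts c and d. It is
    defined for fields along i, so that no extension to the ambient manifold is
    involved. *)
Definition ambient_cov c d X Y (x : 'rV[R]_m) : 'rV[R]_n :=
  'd (pushed c d Y) x (vrep c X x) +
  christoffel nabla d (local_map i c d x) (pushed c d X x) (pushed c d Y x).

(** The Gauss formula computed in fixed charts; meaningful on the common domain of c and d. *)
Definition chart_gauss c d X Y : vfield M := fun p =>
  tanproj p (of_chart d (i p) (ambient_cov c d X Y (coord c p))).

Section AtPoint.
Variables (c : chart R m M) (d : chart R n N) (p : M).
Hypotheses (ac : atlas c) (ad : atlas d) (cp : dom c p) (dp : dom d (i p)).

Let x0 := coord c p.

Lemma local_map_smooth_at : smooth_at (local_map i c d) x0.
Proof. exact: local_map_smooth. Qed.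

Lemma pushed_coord Y : pushed c d Y x0 = to_chart d (i p) (push i p (Y p)).
Proof.
by rewrite /pushed /x0 vrep_coord// (to_chart_push si _ ac ad cp dp).
Qed.

Lemma pushed_smooth Y : vfield_near p Y -> smooth_at (pushed c d Y) x0.
Proof.
move=> Yp; apply: (smooth_at_diff_field (y := id)) => //.
- exact: local_map_smooth_at.
- exact: smooth_at_id.
- exact: vfield_near_rep.
Qed.

Lemma ambient_cov_smooth X Y : vfield_near p X -> vfield_near p Y ->
  smooth_at (ambient_cov c d X Y) x0.
Proof.
move=> Xp Yp; have pY := pushed_smooth Yp; have pX := pushed_smooth Xp.
apply: smooth_atD.
  apply: (smooth_at_diff_field (y := id)) => //; first exact: smooth_at_id.
  exact: vfield_near_rep.
apply: (smooth_at_family2 (A := christoffel nabla d)) => //; last exact: local_map_smooth_at.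
- by rewrite local_map_coord//; exact: near_linear_christoffel_l.
- by rewrite local_map_coord//; exact: near_linear_christoffel_r.
- by move=> w w'; rewrite local_map_coord//; exact: christoffel_smooth.
Qed.

(** The Christoffel terms cancel by symmetry, and the remaining difference is
    i_* of the bracket, which the projection maps back to the bracket. *)
Lemma chart_gauss_bracket X Y : vfield_near p X -> vfield_near p Y ->
  chart_gauss c d X Y p - chart_gauss c d Y X p =
  of_chart c p ('D_(vrep c X x0) (vrep c Y) x0 - 'D_(vrep c Y x0) (vrep c X) x0).
Proof.
move=> Xp Yp; have pY := pushed_smooth Yp; have pX := pushed_smooth Xp.
rewrite /chart_gauss -tanprojB -[RHS](tanproj_push p) (push_of_chart si _ ac ad cp dp).
congr tanproj.
rewrite -of_chartB; congr of_chart; rewrite /ambient_cov -/x0 local_map_coord//.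
rewrite (christoffel_sym (pushed c d Y x0) _ tf ad dp).
rewrite opprD addrACA subrr addr0.
have sch u v : 'D_u (fun y => 'D_v (local_map i c d) y) x0 =
    'D_v (fun y => 'D_u (local_map i c d) y) x0 by exact: schwarz local_map_smooth_at.
have := diff_bracket sch local_map_smooth_at (vfield_near_rep ac cp Xp) (vfield_near_rep ac cp Yp).
apply: etrans; congr (_ - _); apply/esym/deriveE/smooth_at_differentiable.
- exact: pY.
- exact: pX.
Qed.

Lemma chart_gauss_torsion X Y f : vfield_near p X -> vfield_near p Y -> fun_near p f ->
  dderiv p (chart_gauss c d X Y p - chart_gauss c d Y X p) f =
  dderiv p (X p) (fun q => dderiv q (Y q) f)
  - dderiv p (Y p) (fun q => dderiv q (X q) f).
Proof.
move=> Xp Yp fp; have fs := fun_near_rep ac cp fp.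
rewrite (dderiv_dderiv _ ac cp fp Yp) (dderiv_dderiv _ ac cp fp Xp).
rewrite -!(vrep_coord _ cp) chart_gauss_bracket// (dderiv_chart _ ac cp fs) of_chartK//.
have sch u v : 'D_u (fun y => 'D_v (f \o param c) y) x0 =
    'D_v (fun y => 'D_u (f \o param c) y) x0 by exact: schwarz_real.
exact: esym (diff_bracket sch fs (vfield_near_rep ac cp Xp) (vfield_near_rep ac cp Yp)).
Qed.

Lemma pullback_chart_gauss X Y z : gs p (chart_gauss c d X Y p) z =
  rep02 d g (local_map i c d x0) (ambient_cov c d X Y x0) ('d (local_map i c d) x0 (to_chart c p z)).
Proof.
rewrite /chart_gauss tanprojP local_map_coord// rep02_coord//; congr (g _ _ _).
by rewrite -(to_chart_push si _ ac ad cp dp) to_chartK.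
Qed.

Lemma metric_leibniz u V W A B : let y0 := coord d (i p) in
  'd (fun y => rep02 d g y V W) y0 u + rep02 d g y0 V B + rep02 d g y0 A W =
  rep02 d g y0 (A + christoffel nabla d y0 u V) W +
  rep02 d g y0 (B + christoffel nabla d y0 u W) V.
Proof.
move=> y0; rewrite (christoffel_metric _ _ _ sg mc ad dp) -/y0.
have [le _] := (smooth_tensor02P g).1 sg.
have bl : bilin (rep02 d g y0).
  move=> v; split; last by apply: rep02_linear_l => q w; exact: (le q w).2.
  by apply: rep02_linear_r => q w; exact: (le q w).1.
have Bs v w : rep02 d g y0 v w = rep02 d g y0 w v by exact: gsym.
by rewrite !(bilinDl _ _ _ bl) (Bs V) (Bs V); ring.
Qed.

Lemma chart_gauss_metric X Y Z : vfield_near p X -> vfield_near p Y -> vfield_near p Z ->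
  dderiv p (X p) (fun q => gs q (Y q) (Z q)) =
  gs p (chart_gauss c d X Y p) (Z p) + gs p (Y p) (chart_gauss c d X Z p).
Proof.
move=> Xp Yp Zp; have pY := pushed_smooth Yp; have pZ := pushed_smooth Zp.
have [le se] := (smooth_tensor02P g).1 sg.
have L1 : \forall z \near local_map i c d x0, forall w, linear (fun w' => rep02 d g z w' w : R^o).
  by near=> z => w; apply: rep02_linear_l => q z'; exact: (le _ _).2.
have L2 : \forall z \near local_map i c d x0, forall w, linear (rep02 d g z w : _ -> R^o).
  by near=> z => w; apply: rep02_linear_r => q z'; exact: (le _ _).1.
have L3 w w' : smooth_at (fun z => rep02 d g z w w') (local_map i c d x0).
  by rewrite local_map_coord//; exact: se.
have S := smooth_at_family2 L1 L2 L3 local_map_smooth_at pY pZ.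
have E : \forall x \near x0, rep02 d g (local_map i c d x) (pushed c d Y x) (pushed c d Z x) =
    ((fun q => gs q (Y q) (Z q)) \o param c) x.
  apply: filterS (near_chart_map si cp dp) => x [cx xE dx] /=.
  have := pullback2_coord si g (vrep c Y x) (vrep c Z x) ac ad cx dx.
  by rewrite xE /pushed => <-; rewrite /rep02 /vrep !to_chartK.
rewrite (dderiv_chart _ ac cp (near_eq_smooth_at E S)).
rewrite -(vrep_coord X cp) -/x0.
set u0 := vrep c X x0.
transitivity ('D_u0 (fun x => rep02 d g (local_map i c d x)
    (pushed c d Y x) (pushed c d Z x)) x0).
  apply: etrans (near_eq_diff_val _ E (smooth_at_differentiable S)) _.
  exact/esym/deriveE/smooth_at_differentiable.
apply: etrans (deriv_family2 _ L1 L2 L3 local_map_smooth_at pY pZ) _.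
rewrite (deriveE u0 (smooth_at_differentiable local_map_smooth_at)).
rewrite (deriveE u0 (smooth_at_differentiable pY)).
rewrite (deriveE u0 (smooth_at_differentiable pZ)).
have -> : gs p (Y p) (chart_gauss c d X Z p) = gs p (chart_gauss c d X Z p) (Y p) by exact: gsym.
rewrite !pullback_chart_gauss -!(vrep_coord _ cp) -/x0 /ambient_cov local_map_coord//.
exact: metric_leibniz.
Unshelve. all: by end_near. Qed.

Lemma vrepD X Y x : vrep c (fun q => X q + Y q) x = vrep c X x + vrep c Y x.
Proof. exact: linearD. Qed.

Lemma vrepZ f X x : vrep c (fun q => f q *: X q) x = f (param c x) *: vrep c X x.
Proof. exact: linearZ. Qed.

Lemma pushedD X Y : pushed c d (fun q => X q + Y q) = fun z => pushed c d X z + pushed c d Y z.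
Proof. by apply/funext => z; rewrite /pushed vrepD; exact: linearD. Qed.

Lemma pushedZ f X :
  pushed c d (fun q => f q *: X q) = fun z => (f \o param c) z *: pushed c d X z.
Proof. by apply/funext => z; rewrite /pushed vrepZ; exact: linearZ. Qed.

Lemma chart_gauss_linl f X X' Y :
  chart_gauss c d (fun q => f q *: X q + X' q) Y p =
  f p *: chart_gauss c d X Y p + chart_gauss c d X' Y p.
Proof.
rewrite /chart_gauss -tanproj_linear -of_chart_linear; congr (tanproj _ (of_chart _ _ _)).
rewrite -/x0 /ambient_cov pushedD pushedZ vrepD vrepZ /= coordK// local_map_coord//.
rewrite (christoffel_linear_l aff _ ad dp) scalerDr addrACA; congr (_ + _).
exact: linearP.
Qed.

Lemma chart_gauss_addr X Y Y' : vfield_near p Y -> vfield_near p Y' ->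
  chart_gauss c d X (fun q => Y q + Y' q) p = chart_gauss c d X Y p + chart_gauss c d X Y' p.
Proof.
move=> /pushed_smooth sY /pushed_smooth sY'.
rewrite /chart_gauss -tanprojD -of_chartD; congr (tanproj _ (of_chart _ _ _)).
rewrite -/x0 /ambient_cov local_map_coord// (pushedD Y Y').
have := christoffel_linear_r aff (pushed c d X x0) ad dp 1 (pushed c d Y x0) (pushed c d Y' x0).
rewrite !scale1r => G; apply: etrans (congr2 +%R (diffD_val _ sY sY') G) _.
exact: addrACA.
Qed.

Lemma chart_gauss_leibniz f X Y : fun_near p f -> vfield_near p Y ->
  chart_gauss c d X (fun q => f q *: Y q) p =
  dderiv p (X p) f *: Y p + f p *: chart_gauss c d X Y p.
Proof.
move=> fp Yp; have sY := pushed_smooth Yp; have sf := fun_near_rep ac cp fp.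
rewrite (dderiv_chart _ ac cp sf) -(vrep_coord X cp) -/x0.
have YE : Y p = tanproj p (of_chart d (i p) (pushed c d Y x0)).
  by rewrite pushed_coord to_chartK// tanproj_push.
rewrite [X in _ = _ *: X + _]YE /chart_gauss -!tanprojZ -tanprojD -!of_chartZ -of_chartD.
congr (tanproj _ (of_chart _ _ _)).
rewrite -/x0 /ambient_cov local_map_coord// (pushedZ f Y) /= coordK//.
have L := christoffel_linear_r aff (pushed c d X x0) ad dp.
have := L (f p) (pushed c d Y x0) 0.
have -> : christoffel nabla d (coord d (i p)) (pushed c d X x0) 0 = 0.
  by have := L (-1) 0 0; rewrite scaler0 addr0 scaleN1r addNr.
rewrite !addr0 => G; apply: etrans (congr2 +%R (diffZ_val _ sf sY) G) _.
by rewrite /= /x0 coordK// -/x0 scalerDr addrA [X in X + _]addrC.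
Qed.

End AtPoint.

(** Both sides are torsion-free and metric at p, for every choice of charts. *)
Lemma chart_gauss_indep c c' d d' p X Y : atlas c -> atlas c' -> atlas d -> atlas d' ->
  dom c p -> dom c' p -> dom d (i p) -> dom d' (i p) ->
  vfield_near p X -> vfield_near p Y -> chart_gauss c d X Y p = chart_gauss c' d' X Y p.
Proof.
move=> ac ac' ad ad' cp c'p dp d'p.
apply: (levi_civita_unique (induced_metric_bilin p) (fun v w => gsym _ _ _) (@ndg p)
  (T1 := fun X Y => chart_gauss c d X Y p) (T2 := fun X Y => chart_gauss c' d' X Y p)).
- by move=> U V f *; exact: chart_gauss_torsion.
- by move=> U V W *; exact: chart_gauss_metric.
- by move=> U V f *; exact: chart_gauss_torsion.
- by move=> U V W *; exact: chart_gauss_metric.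
Qed.

Lemma chart_gauss_smooth c d p X Y : atlas c -> atlas d -> dom c p -> dom d (i p) ->
  vfield_near p X -> vfield_near p Y -> smooth_at (vrep c (chart_gauss c d X Y)) (coord c p).
Proof.
move=> ac ad cp dp Xp Yp.
apply: (smooth_dual smooth_induced_metric ndg ac cp) => j.
have [le se] := (smooth_tensor02P g).1 sg.
have S : smooth_at (fun x => rep02 d g (local_map i c d x) (ambient_cov c d X Y x)
    ('d (local_map i c d) x 'e_j)) (coord c p).
  apply: (smooth_at_family2 (A := fun y w w' => rep02 d g y w w' : R^o)) => //.
  - by near=> z => w; apply: rep02_linear_l => q z'; exact: (le _ _).2.
  - by near=> z => w; apply: rep02_linear_r => q z'; exact: (le _ _).1.
  - by move=> w w'; rewrite local_map_coord//; exact: se.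
  - exact: local_map_smooth.
  - exact: ambient_cov_smooth.
  - by apply: smooth_at_diff; exact: local_map_smooth.
apply: near_eq_smooth_at S.
apply: filterS (near_chart_map si cp dp) => x [cx xE dx].
have := pullback_chart_gauss ac ad cx dx X Y (of_chart c (param c x) 'e_j).
by rewrite xE of_chartK// => <-.
Unshelve. all: by end_near. Qed.

(** At each point the selected charts are used; they vary without any continuity
    from point to point, and smoothness comes from [chart_gauss_indep]. *)
Definition gauss_nabla X Y : vfield M := fun p =>
  chart_gauss (chart_at p) (chart_at (i p)) X Y p.

Lemma gauss_nablaE c d p X Y : atlas c -> atlas d -> dom c p -> dom d (i p) ->
  vfield_near p X -> vfield_near p Y -> gauss_nabla X Y p = chart_gauss c d X Y p.
Proof.
by move=> *; apply: chart_gauss_indep => //; (exact: chart_at_atlas || exact: chart_at_dom).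
Qed.

Lemma gauss_levi_civita : levi_civita gs gauss_nabla.
Proof.
have a p := @chart_at_atlas _ _ _ p; have a' p := @chart_at_atlas _ _ _ (i p).
have D p := @chart_at_dom _ _ _ p; have D' p := @chart_at_dom _ _ _ (i p).
split; first split.
- move=> p X Y Xp Yp; apply: (vfield_near_chart (a p) (D p)).
  have := chart_gauss_smooth (a p) (a' p) (D p) (D' p) Xp Yp.
  apply: near_eq_smooth_at.
  have H : \forall q \near p, [/\ vfield_near q X, vfield_near q Y,
      dom (chart_at p) q & dom (chart_at (i p)) (i q)].
    have H1 := near_map si (near_dom (D' p)); have H2 := near_dom (D p).
    have H3 : \forall q \near p, vfield_near q X /\ vfield_near q Y.
      by apply: filterS2 (vfield_near_near Xp) (vfield_near_near Yp) => q.
    by apply: filterS3 H3 H2 H1 => q [].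
  apply: filterS (near_chart (D p) H) => x [_ _ [Xq Yq cq dq]].
  by rewrite /vrep (gauss_nablaE (a p) (a' p) cq dq Xq Yq).
- by move=> p f X X' Y fp Xp X'p Yp; exact: chart_gauss_linl.
- by move=> p X Y Y' Xp Yp Y'p; exact: chart_gauss_addr.
- by move=> p f X Y fp Xp Yp; exact: chart_gauss_leibniz.
- by move=> p X Y f Xp Yp fp; exact: chart_gauss_torsion.
- by move=> p X Y Z Xp Yp Zp; exact: chart_gauss_metric.
Qed.

End GaussConnection.

(** * Algebra of Lorentzian almost paracontact structures *)

Section AlmostParacontactAlgebra.
Variables (R : realType) (n : nat) (N : manifold R n).
Variables (phi : tensor11 N) (xi : vfield N) (eta : oneform N) (g : tensor02 N).
Hypothesis lap : lorentzian_almost_paracontact phi xi eta g.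

Let ac := lap_ac lap.

Lemma phi_linear q : linear (phi q).
Proof. exact: (proj1 (ac_phi ac)). Qed.

Lemma lap_bilin q : bilin (g q).
Proof. by case: (lap_metric lap) => sg _ _; exact: tensor02_bilin. Qed.

Lemma lap_sym q v w : g q v w = g q w v.
Proof. by case: (lap_metric lap). Qed.

Lemma phi0 q : phi q 0 = 0.
Proof. by have := phi_linear q (-1) 0 0; rewrite scaler0 addr0 scaleN1r addNr. Qed.

Lemma eta_xi q : eta q (xi q) = -1.
Proof.
have := ac_phi2 ac q (xi q); rewrite (ac_phi_xi ac) phi0.
rewrite -{1}[xi q]scale1r -scalerDl => /esym/eqP.
by rewrite scaler_eq0 (negbTE (ac_xi_neq0 ac q)) orbF addrC addr_eq0 => /eqP.
Qed.

Lemma g_xi_xi q : g q (xi q) (xi q) = -1.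
Proof. by rewrite (lap_xi lap) eta_xi. Qed.

(** Compute phi^3 v in two ways: eta(phi v) xi = phi(eta(v) xi) = 0. *)
Lemma eta_phi q v : eta q (phi q v) = 0.
Proof.
have := ac_phi2 ac q (phi q v); rewrite (ac_phi2 ac q v) [v + _]addrC.
rewrite phi_linear (ac_phi_xi ac) scaler0 add0r -[LHS]addr0 => /addrI/esym/eqP.
by rewrite scaler_eq0 (negbTE (ac_xi_neq0 ac q)) orbF => /eqP.
Qed.

(** Replace w by phi w in the metric condition on phi. *)
Lemma phi_self_adjoint q v w : g q (phi q v) w = g q v (phi q w).
Proof.
have := lap_phi lap q v (phi q w).
rewrite (ac_phi2 ac q w) eta_phi mulr0 addr0 (bilinDr _ _ _ (lap_bilin q)).
by rewrite (bilinZr _ _ _ (lap_bilin q)) (lap_xi lap) eta_phi mulr0 addr0.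
Qed.

End AlmostParacontactAlgebra.

(** * Invariant submanifolds tangent to xi *)

Section InvariantHypersurface.
Variables (R : realType) (m n : nat) (M : manifold R m) (N : manifold R n).
Variables (phi : tensor11 N) (xi : vfield N) (eta : oneform N) (g : tensor02 N).
Variables (i : M -> N) (psi : tensor11 M) (xis : vfield M).
Hypothesis si : smooth_map i.
Hypothesis imm : forall p, injective (push i p).
Hypothesis lap : lorentzian_almost_paracontact phi xi eta g.
Hypothesis psiE : forall p v, phi (i p) (push i p v) = push i p (psi p v).
Hypothesis xisE : forall p, push i p (xis p) = xi (i p).

Let ac := lap_ac lap.
Let etas := pullback1 i eta.
Let gs := pullback2 i g.

Lemma push0 p : push i p 0 = 0.
Proof. exact: linear0. Qed.

Lemma smooth_g : smooth_tensor02 g.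
Proof. by case: (lap_metric lap). Qed.

Lemma induced_metric_xis p v : gs p v (xis p) = etas p v.
Proof. by rewrite /gs /pullback2 xisE (lap_xi lap). Qed.

Lemma induced_metric_sym p v w : gs p v w = gs p w v.
Proof. exact: lap_sym lap _ _ _. Qed.

Lemma induced_metric_xis_xis p : gs p (xis p) (xis p) = -1.
Proof. by rewrite /gs /pullback2 xisE (g_xi_xi lap). Qed.

(** Positive definiteness of g + 2 eta (x) eta restricts to the tangent spaces
    of M, because they contain xi. *)
Lemma induced_metric_posdef p v : v != 0 -> 0 < gs p v v + 2 * gs p v (xis p) ^+ 2.
Proof.
move=> v0; rewrite /gs /pullback2 xisE.
case: (lap_metric lap) => _ gsy lor.
apply: (lorentzian_posdef (lap_bilin lap (i p)) (gsy (i p)) (lor _) (g_xi_xi lap _)).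
by apply: contra_neq v0 => pv; apply: (imm (p := p)); rewrite pv push0.
Qed.

Lemma induced_metric_nondeg p : nondeg (gs p).
Proof. exact: (posdef_nondeg (induced_metric_bilin si smooth_g p) (@induced_metric_posdef p)). Qed.

Lemma psi_linear p : linear (psi p).
Proof.
move=> a u v; apply: (imm (p := p)).
by rewrite -psiE !push_linear (phi_linear lap) !psiE.
Qed.

Lemma xis_smooth : smooth_vfield setT xis.
Proof.
apply/(smooth_in_chartsP (fun c q => to_chart c q (xis q)) openT) => c p ac' cp _.
apply: (smooth_dual (smooth_induced_metric si smooth_g) induced_metric_nondeg ac' cp) => j.
have [_ se] := (smooth_oneformP _).1 (smooth_pullback1 si (ac_eta ac)).
apply: near_eq_smooth_at (se c p 'e_j ac' cp); near=> x.
by rewrite /rep1 -/etas -induced_metric_xis induced_metric_sym.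
Unshelve. all: by end_near. Qed.

Lemma psi_smooth : smooth_tensor11 psi.
Proof.
apply/smooth_tensor11P; split; first exact: psi_linear.
move=> c p u ac' cp; have ad := @chart_at_atlas _ _ _ (i p).
have dp := @chart_at_dom _ _ _ (i p); set d := chart_at (i p) in ad dp.
have [lphi sphi] := (smooth_tensor11P phi).1 (ac_phi ac).
have [le se] := (smooth_tensor02P g).1 smooth_g.
have S1 := local_map_smooth si ac' ad cp dp.
apply: (smooth_dual (X := fun q => psi q (of_chart c q u))
  (smooth_induced_metric si smooth_g) induced_metric_nondeg ac' cp) => j.
have S2 : smooth_at (fun x => rep11 d phi (local_map i c d x) ('d (local_map i c d) x u)) (coord c p).
  apply: (smooth_at_family (A := rep11 d phi)) => //.
  - by near=> z; exact: rep11_linear.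
  - by move=> w; rewrite local_map_coord//; exact: sphi.
  - exact: smooth_at_diff.
have S3 : smooth_at (fun x => rep02 d g (local_map i c d x)
    (rep11 d phi (local_map i c d x) ('d (local_map i c d) x u)) ('d (local_map i c d) x 'e_j)) (coord c p).
  apply: (smooth_at_family2 (A := fun y w w' => rep02 d g y w w' : R^o)) => //.
  - by near=> z => w; apply: rep02_linear_l => q z'; exact: (le _ _).2.
  - by near=> z => w; apply: rep02_linear_r => q z'; exact: (le _ _).1.
  - by move=> w w'; rewrite local_map_coord//; exact: se.
  - exact: smooth_at_diff.
apply: near_eq_smooth_at S3.
apply: filterS (near_chart_map si cp dp) => x [cx xE dx].
have := push_of_chart si u ac' ad cx dx; have := push_of_chart si 'e_j ac' ad cx dx.
have := local_map_coord i d cx; rewrite xE => -> E1 E2.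
rewrite rep02_coord// rep11_coord// to_chartK// -E1 -E2.
by rewrite /pullback2 -psiE.
Unshelve. all: by end_near. Qed.

Lemma induced_almost_paracontact : lorentzian_almost_paracontact psi xis etas gs.
Proof.
split; first split.
- exact: psi_smooth.
- exact: xis_smooth.
- exact: smooth_pullback1 (ac_eta ac).
- move=> p; apply: contra_neq (ac_xi_neq0 ac (i p)) => x0.
  by rewrite -xisE x0 push0.
- by move=> p; apply: (imm (p := p)); rewrite -psiE xisE (ac_phi_xi ac) push0.
- move=> p v; apply: (imm (p := p)); rewrite -!psiE (ac_phi2 ac) -xisE.
  by rewrite [v + _]addrC push_linear addrC.
- split; [exact: smooth_induced_metric si smooth_g|exact: induced_metric_sym|move=> p].
  exact: (posdef_lorentzian (induced_metric_bilin si smooth_g p)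
    (induced_metric_sym p) (induced_metric_xis_xis p) (@induced_metric_posdef p)).
- exact: induced_metric_xis.
- by move=> p v w; rewrite /gs /pullback2 -!psiE (lap_phi lap).
Qed.

(** An operator that preserves a subspace and is self-adjoint commutes with the
    orthogonal projection on it. *)
Lemma tanproj_phi p W : tanproj i g p (phi (i p) W) = psi p (tanproj i g p W).
Proof.
apply: (tanproj_unique si smooth_g induced_metric_nondeg) => z.
rewrite (phi_self_adjoint lap) psiE -(tanprojP si smooth_g induced_metric_nondeg).
by rewrite /gs /pullback2 -!psiE (phi_self_adjoint lap).
Qed.

Variable nabla : vfield N -> vfield N -> vfield N.
Hypothesis lc : levi_civita g nabla.
Hypothesis ps : forall p X Y, vfield_near p X -> vfield_near p Y ->
      nabla_tensor11 nabla phi X Y p =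
      eta p (Y p) *: X p + g p (X p) (Y p) *: xi p
      + (2 * eta p (X p) * eta p (Y p)) *: xi p.

Lemma pushed_psi c d p Y : atlas c -> atlas d -> dom c p -> dom d (i p) ->
  pushed i c d (fun q => psi q (Y q)) (coord c p) =
  rep11 d phi (local_map i c d (coord c p)) (pushed i c d Y (coord c p)).
Proof.
move=> ac' ad cp dp; rewrite !(pushed_coord si ac' ad cp dp) local_map_coord// rep11_coord//.
by rewrite to_chartK// psiE.
Qed.

(** The derivative of phi i_* Y along X, by the chain rule. The derivative of the
    tensor phi is read off from the ambient equation for the coordinate fields
    whose values at i p are i_* X and i_* Y. *)
Lemma ambient_cov_psi c d p X Y : atlas c -> atlas d -> dom c p -> dom d (i p) ->
  vfield_near p X -> vfield_near p Y ->
  of_chart d (i p) (ambient_cov i nabla c d X (fun q => psi q (Y q)) (coord c p)) =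
  etas p (Y p) *: push i p (X p) + gs p (X p) (Y p) *: xi (i p)
  + (2 * etas p (X p) * etas p (Y p)) *: xi (i p)
  + phi (i p) (of_chart d (i p) (ambient_cov i nabla c d X Y (coord c p))).
Proof.
move=> ac' ad cp dp Xp Yp; case: lc => aff _ _.
have [lphi sphi] := (smooth_tensor11P phi).1 (ac_phi ac).
set x0 := coord c p; set y0 := coord d (i p).
have Ey : local_map i c d x0 = y0 by exact: local_map_coord.
have SF := local_map_smooth si ac' ad cp dp.
have SY := pushed_smooth si ac' ad cp dp Yp.
have l1 : \forall z \near local_map i c d x0, linear (rep11 d phi z).
  by near=> z; exact: rep11_linear.
have s1 w : smooth_at (fun y => rep11 d phi y w) (local_map i c d x0).
  by rewrite Ey; exact: sphi.
pose Phi y v := rep11 d phi y v.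
pose A z := Phi (local_map i c d z) (pushed i c d Y z).
have SA : smooth_at A x0 by exact: (smooth_at_family l1 s1 SF SY).
have E : \forall z \near x0, A z = pushed i c d (fun q => psi q (Y q)) z.
  apply: filterS (near_chart_map si cp dp) => z [cz zE dz].
  by have := pushed_psi Y ac' ad cz dz; rewrite zE.
have D1 : 'd (pushed i c d (fun q => psi q (Y q))) x0 (vrep c X x0) =
    'd (fun y => Phi y (pushed i c d Y x0)) y0 (pushed i c d X x0)
    + Phi y0 ('d (pushed i c d Y) x0 (vrep c X x0)).
  apply: etrans (near_eq_diff_val _ E (smooth_at_differentiable SA)) _.
  apply: etrans (esym (deriveE _ (smooth_at_differentiable SA))) _.
  apply: etrans (deriv_family _ l1 s1 SF SY) _.
  rewrite Ey (deriveE _ (smooth_at_differentiable SF)).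
  by rewrite (deriveE _ (smooth_at_differentiable SY)).
rewrite {1}/ambient_cov D1 (pushed_psi Y ac' ad cp dp) -/x0 Ey.
set U := pushed i c d X x0; set V := pushed i c d Y x0.
have T := to_chart_nabla_tensor11 aff U V (ac_phi ac) ad dp.
have := ps (coord_field_near U ad dp) (coord_field_near V ad dp).
have XU : coord_field d U (i p) = push i p (X p).
  by rewrite /coord_field /U (pushed_coord si ac' ad cp dp) to_chartK.
have YV : coord_field d V (i p) = push i p (Y p).
  by rewrite /coord_field /V (pushed_coord si ac' ad cp dp) to_chartK.
rewrite XU YV => T'.
rewrite -[X in X + phi _ _]T' -[nabla_tensor11 _ _ _ _ _](to_chartK _ ad dp) T.
have -> : phi (i p) (of_chart d (i p) (ambient_cov i nabla c d X Y x0)) =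
    of_chart d (i p) (Phi y0 (ambient_cov i nabla c d X Y x0)).
  by rewrite /Phi /y0 rep11_coord// to_chartK.
rewrite -of_chartD; congr of_chart.
rewrite /ambient_cov Ey -/U -/V.
have lP : forall u v, Phi y0 (u + v) = Phi y0 u + Phi y0 v.
  by move=> u v; have := rep11_linear d y0 lphi 1 u v; rewrite !scale1r.
rewrite lP -/y0 -/(Phi y0 V).
rewrite -/(Phi y0 (christoffel nabla d y0 U V)).
by rewrite [in RHS]addrACA addNr addr0 addrAC.
Unshelve. all: by end_near. Qed.

Lemma induced_para_sasakian : lorentzian_para_sasakian psi xis etas gs.
Proof.
case: (lc) => aff tf mc.
split; first exact: induced_almost_paracontact.
exists (gauss_nabla i g nabla); split.
  exact: gauss_levi_civita si smooth_g (lap_sym lap) aff tf mc induced_metric_nondeg.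
move=> p X Y Xp Yp.
have a := @chart_at_atlas _ _ _ p; have a' := @chart_at_atlas _ _ _ (i p).
have D := @chart_at_dom _ _ _ p; have D' := @chart_at_dom _ _ _ (i p).
rewrite /nabla_tensor11 /gauss_nabla {1}/chart_gauss (ambient_cov_psi a a' D D' Xp Yp) -xisE.
have tD := tanprojD si smooth_g induced_metric_nondeg.
have tZ := tanprojZ si smooth_g induced_metric_nondeg.
rewrite !tD !tZ !(tanproj_push si smooth_g induced_metric_nondeg) tanproj_phi.
by rewrite -/(chart_gauss i g nabla _ _ X Y p) addrK.
Qed.

End InvariantHypersurface.

Theorem theorem5p10 (R : realType) (n : nat)
    (Mbar : manifold R n.+1) (M : manifold R n)
    (phi : tensor11 Mbar) (xi : vfield Mbar) (eta : oneform Mbar)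
    (gbar : tensor02 Mbar) (i : M -> Mbar)
    (hMbar : lorentzian_para_sasakian phi xi eta gbar)
    (hi : imbedding i)
    (hxi : tangent_along i xi)
    (hinv : invariant_under i phi) :
  exists (psi : tensor11 M) (xis : vfield M),
    [/\ forall p v, phi (i p) (push i p v) = push i p (psi p v),
        forall p, push i p (xis p) = xi (i p)
      & lorentzian_para_sasakian psi xis (pullback1 i eta) (pullback2 i gbar)].
Proof.
case: hMbar => lap [nabla [lc ps]]; case: hi => si imm _ _.
pose psi p v := projT1 (cid (hinv p v)); pose xis p := projT1 (cid (hxi p)).
have psiE p v : phi (i p) (push i p v) = push i p (psi p v).
  exact: projT2 (cid (hinv p v)).
have xisE p : push i p (xis p) = xi (i p) by exact: projT2 (cid (hxi p)).
exists psi, xis; split => //.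
have H := induced_para_sasakian si imm lap psiE xisE lc ps.
exact H.
Qed.
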